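(* Let $\Lambda$ be the weight lattice of a semisimple root system with Weyl group $W$ and fundamental weights $\omega_1,\ldots,\omega_n$ (a $\mathbb{Z}$-basis of $\Lambda$), and let $T^*\subset\Lambda$ be a subgroup of index $2$ (the character lattice of a split maximal torus of the corresponding group $G$). Use the notation $n'$, $s_j$, $d_i$, $d$, $a_{i,j}$, $\rho(\omega_i)$, $\rho_i$, $\tilde\rho_i$, $\tilde\rho(\omega_i)$, $\lambda_0$, $r_i$, $h_{1,i},h_{2,i},h_{3,i}$ and $I^W_{sc}$ described in the context. Assume that the $n$-tuple $(\rho_1,\ldots,\rho_n)$ satisfies the generalized flatness condition (over $R=\mathbb{Z}$) with respect to some $\mathbb{Z}$-basis $\{x_1,\ldots,x_n\}$ of $\Lambda$. Then the elements $$h_{1,i}\ (1\le i<n'),\qquad h_{2,i}\ (1\le i\le n'),\qquad h_{3,i}\ (n'<i\le n)$$ generate the ideal $I^W_{sc}\cap\mathbb{Z}[T^*]$ of the ring $\mathbb{Z}[T^*]$.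
   Context: For a ring $R$ (here $R=\mathbb{Z}$ or $\mathbb{Z}/m\mathbb{Z}$, $m\ge 2$) and a free abelian group $\Lambda$ with basis $x_1,\ldots,x_n$, $R[\Lambda]$ is the group ring, identified with the Laurent polynomial ring $R[x_1^{\pm1},\ldots,x_n^{\pm1}]$; $\Lambda_i$ denotes the subgroup spanned by $x_1,\ldots,x_i$. A polynomial $p\in R[\Lambda_i]$ is a divisor with respect to $x_i$ if, writing $p=p_kx_i^k+\cdots+p_mx_i^m$ with $p_j\in R[\Lambda_{i-1}]$, $p_k\neq0$, the leading coefficient $p_k$ is a monic monomial in $x_1,\ldots,x_{i-1}$ (coefficient $1$). An $n$-tuple $(q_1,\ldots,q_n)$ satisfies the flatness condition if $q_i\in R[\Lambda_i]$ and $q_i$ is a divisor with respect to $x_i$ for each $i$; it satisfies the generalized flatness condition if there is $A\in GL_n(R[\Lambda])$ such that $(q_1,\ldots,q_n)A$ satisfies the flatness condition. Grading: each $\lambda\in\Lambda$ has degree $|\lambda|\in\Lambda/T^*=\mathbb{Z}/2\mathbb{Z}$; $\Lambda^{(0)}=T^*$, $\Lambda^{(1)}=\Lambda\setminus T^*$. After reindexing, $\omega_1,\ldots,\omega_{n'}\notin T^*$ and $\omega_{n'+1},\ldots,\omega_n\in T^*$. Put $s_j=|W(\omega_j)|$ (size of the $W$-orbit), $\rho(\omega_j)=\sum_{\lambda\in W(\omega_j)}e^{\lambda}\in\mathbb{Z}[\Lambda]$, $\rho_j=\rho(\omega_j)-s_j$. For $1\le i\le n'$ let $d_i=\gcd(s_i,s_{i+1},\ldots,s_{n'})$,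 $d=d_1$, and fix integers $a_{i,j}$ ($i\le j\le n'$) with $d_i=\sum_{j=i}^{n'}a_{i,j}s_j$; set $\tilde\rho_i=\sum_{j=i}^{n'}a_{i,j}\rho_j$ and $\tilde\rho(\omega_i)=\tilde\rho_i+d_i$. Fix $\lambda_0\in\Lambda^{(1)}$. Define, for $1\le i<n'$ with $r_i=\operatorname{lcm}(s_i,d_{i+1})$, $h_{1,i}=e^{\lambda_0}\big(\tfrac{r_i}{s_i}\rho(\omega_i)-\tfrac{r_i}{d_{i+1}}\tilde\rho(\omega_{i+1})\big)$; for $1\le i\le n'$, $h_{2,i}=\rho(\omega_i)\tilde\rho(\omega_1)-d s_i$; for $n'<i\le n$, $h_{3,i}=\rho_i$. These lie in $\mathbb{Z}[T^*]$. $I^W_{sc}$ is the ideal of $\mathbb{Z}[\Lambda]$ generated by the $W$-invariant elements of the augmentation ideal (kernel of $\mathbb{Z}[\Lambda]\to\mathbb{Z}$, $e^\lambda\mapsto1$). *)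

(* Defs.v *)
From HB Require Import structures.
From mathcomp Require Import all_boot all_order all_algebra.
From mathcomp Require Import finmap.
From mathcomp.multinomials Require Import monalg.
From Stdlib Require Import ClassicalEpsilon.
Set Implicit Arguments. Unset Strict Implicit. Unset Printing Implicit Defensive.
Import GRing.Theory.
Local Open Scope fset_scope.
Local Open Scope ring_scope.

Definition grpalg (K : zmodType) (R : comRingType) := {malg R[K]}.
HB.instance Definition _ K R := GRing.Zmodule.on (grpalg K R).
HB.instance Definition _ K R := Choice.on (grpalg K R).

Section GrpAlg.
Context (K : zmodType) (R : comRingType).
Implicit Types (g : grpalg K R).

Definition gaone : grpalg K R := << 0%R >>.
Definition gamul_def g1 g2 : grpalg K R :=
  \sum_(k1 <- msupp g1) \sum_(k2 <- msupp g2) << g1@_k1 * g2@_k2 *g (k1 + k2) >>.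

Fact gamul_key : unit. Proof. by []. Qed.
Definition gamul := locked_with gamul_key gamul_def.
Lemma gamulE g1 g2 : gamul g1 g2 =
  \sum_(k1 <- msupp g1) \sum_(k2 <- msupp g2) << g1@_k1 * g2@_k2 *g (k1 + k2) >>.
Proof. by rewrite [gamul]unlock. Qed.

Lemma gamulw (d1 d2 : {fset K}) g1 g2 :
  msupp g1 `<=` d1 -> msupp g2 `<=` d2 ->
  gamul g1 g2 = \sum_(k1 <- d1) \sum_(k2 <- d2) << g1@_k1 * g2@_k2 *g (k1 + k2) >>.
Proof.
move=> le_d1 le_d2; rewrite gamulE (big_fset_incl _ le_d1) /=.
  apply/eq_bigr=> k1 _; apply/big_fset_incl => // k _ /mcoeff_outdom ->.
  by rewrite mulr0 monalgU0.
move=> k _ /mcoeff_outdom g1k.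
by rewrite big1 => // k' _; rewrite g1k mul0r monalgU0.
Qed.

Lemma gamul0g g : gamul 0 g = 0.
Proof. by rewrite gamulE msupp0 big_seq_fset0. Qed.
Lemma gamulg0 g : gamul g 0 = 0.
Proof. by rewrite gamulE exchange_big msupp0 big_seq_fset0. Qed.

Lemma gamulUU c1 c2 k1 k2 :
  gamul << c1 *g k1 >> << c2 *g k2 >> = << c1 * c2 *g (k1 + k2) >>.
Proof. by rewrite (gamulw msuppU_le msuppU_le) !big_seq_fset1 !mcoeffUU. Qed.

Lemma gamulDl g1 g2 g : gamul (g1 + g2) g = gamul g1 g + gamul g2 g.
Proof.
rewrite [in RHS](@gamulw _ (msupp g) g1 g (fsubsetUl _ (msupp g2)) (fsubset_refl _)).
rewrite [in RHS](@gamulw _ (msupp g) g2 g (fsubsetUr (msupp g1) _) (fsubset_refl _)).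
rewrite (@gamulw _ (msupp g) _ g (msuppD_le _ _) (fsubset_refl _)).
rewrite -big_split /=; apply/eq_bigr=> k1 _.
rewrite -big_split /=; apply/eq_bigr=> k2 _.
by rewrite mcoeffD mulrDl monalgUD.
Qed.

Lemma gamulC g1 g2 : gamul g1 g2 = gamul g2 g1.
Proof.
rewrite !gamulE exchange_big; apply/eq_bigr=> k1 _; apply/eq_bigr=> k2 _.
by rewrite mulrC addrC.
Qed.

Lemma gamulDr g g1 g2 : gamul g (g1 + g2) = gamul g g1 + gamul g g2.
Proof. by rewrite !(gamulC g) gamulDl. Qed.

Lemma gamul_suml (I : Type) (r : seq I) (F : I -> grpalg K R) g :
  gamul (\sum_(i <- r) F i) g = \sum_(i <- r) gamul (F i) g.
Proof. exact: (big_morph (gamul^~ g) (fun a b => gamulDl a b g) (gamul0g g)). Qed.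
Lemma gamul_sumr (I : Type) (r : seq I) (F : I -> grpalg K R) g :
  gamul g (\sum_(i <- r) F i) = \sum_(i <- r) gamul g (F i).
Proof. exact: (big_morph (gamul g) (fun a b => gamulDr g a b) (gamulg0 g)). Qed.

Lemma gamulA g1 g2 g3 : gamul g1 (gamul g2 g3) = gamul (gamul g1 g2) g3.
Proof.
have E (g : grpalg K R) : g = \sum_(k <- msupp g) << g@_k *g k >> := monalgE g.
rewrite [g1 in LHS]E [g1 in RHS]E !gamul_suml; apply: eq_bigr => k1 _.
rewrite [g2 in LHS]E [g2 in RHS]E gamul_suml gamul_sumr gamul_sumr gamul_suml.
apply: eq_bigr => k2 _.
rewrite gamulUU [g3 in LHS]E [g3 in RHS]E !gamul_sumr; apply: eq_bigr => k3 _.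
by rewrite !gamulUU mulrA addrA.
Qed.

Lemma gamul1g g : gamul gaone g = g.
Proof.
rewrite /gaone [in LHS](monalgE g) gamul_sumr [RHS]monalgE.
by apply/eq_bigr=> k _; rewrite gamulUU mul1r add0r.
Qed.
Lemma gamulg1 g : gamul g gaone = g.
Proof. by rewrite gamulC gamul1g. Qed.

Lemma gaone_neq0 : gaone != 0.
Proof. by apply/eqP/malgP=> /(_ 0%R) /eqP; rewrite mcoeffUU mcoeff0 oner_eq0. Qed.

HB.instance Definition _ := GRing.Zmodule_isComRing.Build (grpalg K R)
  gamulA gamulC gamul1g gamulDl gaone_neq0.
End GrpAlg.

(* The weight lattice of a semisimple root system, given by its Cartan   *)
(* matrix, written in the basis of fundamental weights.                  *)
(* Lambda = Z^n with omega_i = i-th standard basis vector (0-indexed).   *)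

Definition lat (n : nat) := 'rV[int]_n.
Definition ZL (n : nat) := grpalg (lat n) int.

Section RootData.
Variable n : nat.
Implicit Types (C : 'M[int]_n) (l mu : lat n) (f g : ZL n).

Definition ex l : ZL n := << l >>.

(* fundamental weight omega_j (0-indexed; 0 if j >= n, never used so) *)
Definition omegan (j : nat) : lat n := \row_(k < n) ((k == j :> nat)%:R : int).

(* C is a Cartan matrix of finite type (i.e. of a reduced semisimple root
   system): C i j = <alpha_i, alpha_j^vee>, C i i = 2, C i j <= 0 for i != j,
   symmetrizable by a positive diagonal matrix with positive definite
   symmetrization. *)
Definition finite_cartan C : Prop :=
  [/\ forall i, C i i = 2,
      forall i j, i != j -> C i j <= 0 &
      exists d : 'I_n -> int,
        [/\ forall i, 0 < d i,
            forall i j, C i j * d j = C j i * d i &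
            forall x : 'I_n -> rat, (exists i, x i != 0) ->
              0 < \sum_i \sum_j x i * (C i j * d j)%:~R * x j]].

(* the simple root alpha_i in the basis of fundamental weights is row i C;
   the simple reflection s_i(l) = l - <l, alpha_i^vee> alpha_i *)
Definition refl C (i : 'I_n) l : lat n := l - (l 0 i) *: row i C.

Definition weyl_act C (w : seq 'I_n) l : lat n := foldr (refl C) l w.

Definition in_orbit C l mu : Prop := exists w, mu = weyl_act C w l.

Definition orbit C l : {fset lat n} :=
  epsilon (inhabits fset0) (fun S : {fset lat n} => forall mu, mu \in S <-> in_orbit C l mu).

Definition rho C l : ZL n := \sum_(mu <- orbit C l) ex mu.

Definition wact C (i : 'I_n) f : ZL n :=
  \sum_(mu <- msupp f) << f@_mu *g refl C i mu >>.

Definition W_invariant C f : Prop := forall i, wact C i f = f.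

Definition augm f : int := \sum_(mu <- msupp f) f@_mu.

Definition gen_ideal (S P : ZL n -> Prop) f : Prop :=
  exists m (c g : 'I_m -> ZL n),
    (forall k, S (c k) /\ P (g k)) /\ f = \sum_(k < m) c k * g k.

Definition I_sc C f : Prop :=
  gen_ideal (fun _ => True) (fun g => W_invariant C g /\ augm g = 0) f.

Definition in_ZT (T : lat n -> Prop) f : Prop := forall mu, mu \in msupp f -> T mu.

(* ---- the notation of the context (all indices 0-based) ---- *)
Definition ssz C (j : nat) : nat := #|` orbit C (omegan j)|.
Definition rhoo C (j : nat) : ZL n := rho C (omegan j).
Definition rhoj C (j : nat) : ZL n := rhoo C j - (ssz C j)%:R.
Definition dd C (n' i : nat) : nat := \big[gcdn/0%N]_(i <= j < n') ssz C j.
Definition rhot C (n' : nat) (a : nat -> nat -> int) (i : nat) : ZL n :=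
  \sum_(i <= j < n') (a i j)%:~R * rhoj C j.
Definition rhotw C n' a i : ZL n := rhot C n' a i + (dd C n' i)%:R.
Definition rr C n' (i : nat) : nat := lcmn (ssz C i) (dd C n' i.+1).
Definition h1 C n' a (l0 : lat n) (i : nat) : ZL n :=
  ex l0 * ((rr C n' i %/ ssz C i)%:R * rhoo C i
           - (rr C n' i %/ dd C n' i.+1)%:R * rhotw C n' a i.+1).
Definition h2 C n' a (i : nat) : ZL n :=
  rhoo C i * rhotw C n' a 0 - (dd C n' 0 * ssz C i)%:R.
Definition h3 C (i : nat) : ZL n := rhoj C i.

Definition gens_h C n' a l0 (g : ZL n) : Prop :=
  (exists i, (i.+1 < n')%N /\ g = h1 C n' a l0 i) \/
  (exists i, (i < n')%N /\ g = h2 C n' a i) \/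
  (exists i, (n' <= i < n)%N /\ g = h3 C i).

(* X : rows x_0, ..., x_{n-1} form a Z-basis of Lambda (X \in unitmx);
   coordinates of mu in that basis are mu *m invmx X.
   inspan X k mu  <->  mu lies in the span of x_0, ..., x_{k-1}.        *)
Definition inspan (X : 'M[int]_n) (k : nat) (mu : lat n) : Prop :=
  forall j : 'I_n, (k <= j)%N -> (mu *m invmx X) 0 j = 0.

(* writing p = sum_j p_j x_i^j, the coefficient p_j (an element of
   Z[span(x_0..x_{i-1})] when p \in Z[span(x_0..x_i)]) *)
Definition xcoef (X : 'M[int]_n) (i : 'I_n) (p : ZL n) (j : int) : ZL n :=
  \sum_(mu <- msupp p | (mu *m invmx X) 0 i == j)
     << p@_mu *g mu - j *: row i X >>.

Definition divisor (X : 'M[int]_n) (i : 'I_n) (p : ZL n) : Prop :=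
  exists k : int,
    (forall j, j < k -> xcoef X i p j = 0) /\
    exists nu, inspan X i nu /\ xcoef X i p k = ex nu.

Definition flatness (X : 'M[int]_n) (q : 'I_n -> ZL n) : Prop :=
  forall i : 'I_n,
    (forall mu, mu \in msupp (q i) -> inspan X i.+1 mu) /\ divisor X i (q i).

Definition gen_flatness (q : 'I_n -> ZL n) : Prop :=
  exists X : 'M[int]_n, X \in unitmx /\
  exists A B : 'M[ZL n]_n, [/\ A *m B = 1%:M, B *m A = 1%:M &
     flatness X (fun j => ((\row_i q i) *m A) 0 j)].

End RootData.

(* Main.v *)
(** Weyl orbits are finite because they lie on a sphere of the invariant form.
    Reflecting a weight in a simple root on which it is negative is a
    terminating rewriting system, locally confluent by inspection of the rank
    two Cartan matrices; hence an orbit has a unique dominant weight and all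
    others lie below it, [rho(omega_j)] has leading term [e^omega_j], and by
    triangularity [I_sc] is generated by [rho_0, ..., rho_{n-1}].

    Flatness makes [(q_0, ..., q_{n-1}) = (rho_0, ..., rho_{n-1}) A] a regular
    sequence modulo [d], so every syzygy of the [rho_j] modulo [d] is of Koszul
    type.  If [f = sum_j F_j rho_j] lies in [Z[T]], the odd component of this
    identity says that the parts of the [F_j] of the wrong parity are a syzygy
    modulo [d]; subtracting a Koszul syzygy makes them divisible by [d].  The odd
    component divided by [d] and multiplied by [rhotw 0], added to the even one,
    then exhibits [f] as a combination of the [h]'s. *)
Require Import Defs.
From HB Require Import structures.
From mathcomp Require Import all_boot all_order all_algebra.
From mathcomp Require Import finmap ring lra zify.
From mathcomp.multinomials Require Import monalg.
From Stdlib Require Import ClassicalEpsilon.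
Set Implicit Arguments. Unset Strict Implicit. Unset Printing Implicit Defensive.
Import Order.TTheory GRing.Theory Num.Theory.
(* [all_boot] shadows [orbit] and [in_orbit]. *)
Import Defs.
Local Open Scope fset_scope.
Local Open Scope ring_scope.

(** * Group algebras and ideals *)

Section GroupAlgebra.
Context (K : zmodType) (R : comRingType).
Implicit Types (f g h : grpalg K R) (P : pred K) (Q : K -> Prop).

Lemma grpalgUM (c1 c2 : R) (k1 k2 : K) :
  (<< c1 *g k1 >> : grpalg K R) * << c2 *g k2 >> = << c1 * c2 *g k1 + k2 >>.
Proof. exact: gamulUU. Qed.

Lemma grpalg_ind (Pr : grpalg K R -> Prop) :
  Pr 0 -> (forall c k g, Pr g -> Pr (<< c *g k >> + g)) -> forall f, Pr f.
Proof.
move=> P0 PD f; rewrite (monalgE f).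
by elim: (enum_fset (msupp f)) => [|k s IH]; rewrite ?big_nil // big_cons; apply: PD.
Qed.

(** Phrased through coefficients, so that closure properties follow from the formulas for [mcoeff];
    [in_ZTP] identifies it with [in_ZT]. *)
Definition supp_in Q f := forall k, f@_k != 0 -> Q k.

Lemma supp_in0 Q : supp_in Q 0.
Proof. by move=> k; rewrite mcoeff0 eqxx. Qed.

Lemma supp_inU Q c k : Q k -> supp_in Q << c *g k >>.
Proof.
move=> Qk k'; rewrite mcoeffU; case: (k =P k') => [<- //|_].
by rewrite mulr0n eqxx.
Qed.

Lemma supp_inD Q f g : supp_in Q f -> supp_in Q g -> supp_in Q (f + g).
Proof.
move=> Qf Qg k; rewrite mcoeffD; case: (f@_k =P 0) => [->|/eqP/Qf //].
by rewrite add0r => /Qg.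
Qed.

Lemma supp_inN Q f : supp_in Q f -> supp_in Q (- f).
Proof. by move=> Qf k; rewrite mcoeffN oppr_eq0 => /Qf. Qed.

Lemma supp_in_sum Q (I : Type) (r : seq I) (p : pred I) (F : I -> grpalg K R) :
  (forall i, p i -> supp_in Q (F i)) -> supp_in Q (\sum_(i <- r | p i) F i).
Proof.
move=> QF; elim/big_ind: _ => //; [exact: supp_in0|move=> *; exact: supp_inD].
Qed.

Lemma supp_inM (Q1 Q2 Q : K -> Prop) f g :
  (forall k1 k2, Q1 k1 -> Q2 k2 -> Q (k1 + k2)) ->
  supp_in Q1 f -> supp_in Q2 g -> supp_in Q (f * g).
Proof.
move=> QD Qf Qg; rewrite [f * g]gamulE big_seq; apply: supp_in_sum => k1 k1f.
rewrite big_seq; apply: supp_in_sum => k2 k2g; apply: supp_inU.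
by apply: QD; [apply: Qf|apply: Qg]; rewrite mcoeff_neq0.
Qed.

Lemma supp_inW (Q1 Q2 : K -> Prop) f :
  (forall k, Q1 k -> Q2 k) -> supp_in Q1 f -> supp_in Q2 f.
Proof. by move=> QW Qf k /Qf /QW. Qed.

Definition restr P f : grpalg K R := [malg k in msupp f => if P k then f@_k else 0].

Lemma mcoeff_restr P f k : (restr P f)@_k = if P k then f@_k else 0.
Proof. by rewrite mcoeffE; case: msuppP => //; case: ifP. Qed.

Lemma restrE P f : restr P f = \sum_(k <- msupp f | P k) << f@_k *g k >>.
Proof.
rewrite [LHS](@monalgEw _ _ _ (msupp f)); last first.
  apply/fsubsetP => k; rewrite -!mcoeff_neq0 mcoeff_restr.
  by case: ifP => //; rewrite eqxx.
rewrite [RHS]big_mkcond; apply: eq_bigr => k _.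
by rewrite mcoeff_restr; case: ifP => // _; rewrite monalgU0.
Qed.

Fact restr_is_additive P : zmod_morphism (restr P).
Proof.
move=> f g; apply/malgP => k; rewrite mcoeffB !mcoeff_restr mcoeffB.
by case: ifP; rewrite ?subr0.
Qed.
HB.instance Definition _ P :=
  GRing.isZmodMorphism.Build (grpalg K R) (grpalg K R) (restr P) (restr_is_additive P).

Lemma restr_id P f : supp_in P f -> restr P f = f.
Proof.
move=> Pf; apply/malgP => k; rewrite mcoeff_restr; case: ifP => // /negP nP.
by case: (f@_k =P 0) => [->//|/eqP/Pf].
Qed.

Lemma restr_eq0 P f : supp_in (fun k => ~ P k) f -> restr P f = 0.
Proof.
move=> Pf; apply/malgP => k; rewrite mcoeff_restr mcoeff0; case: ifP => // Pk.
by case: (f@_k =P 0) => [->//|/eqP/Pf /(_ Pk)].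
Qed.

Lemma supp_restr P f : supp_in P (restr P f).
Proof. by move=> k; rewrite mcoeff_restr; case: ifP; rewrite ?eqxx. Qed.

Lemma restrC P f : restr (predC P) f = f - restr P f.
Proof.
apply/malgP => k; rewrite mcoeffB !mcoeff_restr /=.
by case: (P k); rewrite ?subrr ?subr0.
Qed.

(** Translation by any weight of [g] carries [P'] to [P], so the two pieces of [f] cut out by [P']
    have products with [g] lying wholly inside and wholly outside [P]. It serves both for factors of
    degree zero in a grading and for factors of fixed parity. *)
Lemma restrM P P' f g :
  supp_in (fun k => forall l, P (l + k) = P' l) g ->
  restr P (f * g) = restr P' f * g.
Proof.
move=> Pg; have -> : f = restr P' f + restr (predC P') f by rewrite restrC addrC subrK.
set f1 := restr P' f; set f2 := restr _ f.
have f1P : supp_in P' f1 by apply: supp_restr.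
have f2P : supp_in (fun k => ~ P' k) f2.
  by apply: supp_inW (@supp_restr _ _) => k /= /negP.
rewrite mulrDl 2!raddfD /= (@restr_id P (f1 * g)).
  rewrite (@restr_eq0 P (f2 * g)) ?addr0.
    by rewrite (restr_id f1P) (restr_eq0 f2P) addr0.
  by apply: supp_inM f2P Pg => k1 k2 nP E; rewrite E.
by apply: supp_inM f1P Pg => k1 k2 nP E; rewrite E.
Qed.

End GroupAlgebra.

Section Augmentation.
Variable n : nat.
Implicit Types (f g : ZL n).

Lemma exM (l m : lat n) : ex l * ex m = ex (l + m).
Proof. by rewrite /ex grpalgUM mulr1. Qed.

Lemma ex0 : ex (0 : lat n) = 1. Proof. by []. Qed.

Lemma exNK (l : lat n) f : ex (- l) * (ex l * f) = f.
Proof. by rewrite mulrA exM addNr ex0 mul1r. Qed.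

Lemma augmE f : augm f = mmap idfun (fun=> 1) f.
Proof. by rewrite mmapE; apply: eq_bigr => k _; rewrite mulr1. Qed.

Lemma augmU c (k : lat n) : augm << c *g k >> = c.
Proof. by rewrite augmE mmapU mulr1. Qed.

Fact augm_is_additive : zmod_morphism (@augm n).
Proof. by move=> f g; rewrite !augmE mmapB. Qed.
HB.instance Definition _ :=
  GRing.isZmodMorphism.Build (ZL n) int (@augm n) augm_is_additive.

Fact augm_is_multiplicative : monoid_morphism (@augm n).
Proof.
split=> [|f g]; first exact: augmU.
elim/grpalg_ind: f => [|c k f IH]; first by rewrite mul0r raddf0 mul0r.
rewrite mulrDl !raddfD /= IH mulrDl; congr (_ + _).
elim/grpalg_ind: g {IH f} => [|c' k' g IH]; first by rewrite mulr0 raddf0 mulr0.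
by rewrite mulrDr !raddfD /= IH grpalgUM !augmU mulrDr.
Qed.
HB.instance Definition _ :=
  GRing.isMonoidMorphism.Build (ZL n) int (@augm n) augm_is_multiplicative.

Lemma in_ZTP (T : lat n -> Prop) f : in_ZT T f <-> supp_in T f.
Proof. by split=> Tf k; have := Tf k; rewrite mcoeff_neq0. Qed.

End Augmentation.

Section Ideals.
Variable n : nat.
Implicit Types (f g : ZL n) (S P : ZL n -> Prop).

Lemma gen_ideal0 S P : gen_ideal S P 0.
Proof. by exists 0%N, (fun=> 0), (fun=> 0); split; [case|rewrite big_ord0]. Qed.

Lemma gen_ideal_mul S P c g : S c -> P g -> gen_ideal S P (c * g).
Proof. by move=> Sc Pg; exists 1%N, (fun=> c), (fun=> g); rewrite big_ord1. Qed.

Lemma gen_idealD S P f g : gen_ideal S P f -> gen_ideal S P g -> gen_ideal S P (f + g).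
Proof.
move=> [m [c [u [H ->]]]] [m' [c' [u' [H' ->]]]].
exists (m + m')%N.
exists (fun i => match split i with inl j => c j | inr j => c' j end).
exists (fun i => match split i with inl j => u j | inr j => u' j end).
split=> [k|]; first by case: split => j; [apply: H|apply: H'].
rewrite big_split_ord /=; congr (_ + _); apply: eq_bigr => i _.
  by rewrite -[lshift _ _]/(unsplit (inl i)) unsplitK.
by rewrite -[rshift _ _]/(unsplit (inr i)) unsplitK.
Qed.

Lemma gen_ideal_sum S P (I : Type) (r : seq I) (p : pred I) (F : I -> ZL n) :
  (forall i, p i -> gen_ideal S P (F i)) -> gen_ideal S P (\sum_(i <- r | p i) F i).
Proof.
move=> PF; elim/big_ind: _ => //; [exact: gen_ideal0|move=> *; exact: gen_idealD].
Qed.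

Lemma gen_idealMl P c f :
  gen_ideal (fun=> True) P f -> gen_ideal (fun=> True) P (c * f).
Proof.
move=> [m [d [u [H ->]]]]; rewrite mulr_sumr; apply: gen_ideal_sum => i _.
by rewrite mulrA; apply: gen_ideal_mul => //; case: (H i).
Qed.

Lemma gen_ideal_gen P f : P f -> gen_ideal (fun=> True) P f.
Proof. by move=> Pf; rewrite -[f]mul1r; apply: gen_ideal_mul. Qed.

End Ideals.

(** * Regular sequences and Koszul syzygies *)

Section Koszul.
Variables (R : comRingType) (d : R) (q : nat -> R).

(** The ideal generated by [d] and [q 0, ..., q (k-1)]. *)
Definition in_initial (k : nat) (g : R) : Prop :=
  exists (c : nat -> R) (w : R), g = \sum_(l < k) c l * q l + d * w.

Lemma in_initial0 k : in_initial k 0.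
Proof.
by exists (fun=> 0), 0; rewrite mulr0 addr0 big1 // => l _; rewrite mul0r.
Qed.

Lemma in_initialD k f g : in_initial k f -> in_initial k g -> in_initial k (f + g).
Proof.
move=> [c [w ->]] [c' [w' ->]]; exists (fun l => c l + c' l), (w + w').
by rewrite addrACA -big_split mulrDr; under [in RHS]eq_bigr do rewrite mulrDl.
Qed.

Lemma in_initialMl k h g : in_initial k g -> in_initial k (h * g).
Proof.
move=> [c [w ->]]; exists (fun l => h * c l), (h * w).
rewrite mulrDr mulr_sumr mulrCA; congr (_ + _).
by apply: eq_bigr => l _; rewrite mulrA.
Qed.

(** Induction on [k]: regularity places the last coefficient in the ideal of [d] and the earlier
    [q l], which leaves a shorter syzygy. Writing the skew matrix as [V j l - V l j] spares a
    separate skewness condition. *)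
Lemma koszul_syzygy k :
  (forall i, (i < k)%N -> forall g, in_initial i (g * q i) -> in_initial i g) ->
  forall (g : nat -> R) (w : R), \sum_(j < k) g j * q j = d * w ->
  exists (V : nat -> nat -> R) (v : nat -> R), forall j, (j < k)%N ->
    g j = \sum_(l < k) (V j l - V l j) * q l + d * v j.
Proof.
elim: k => [|k IH] reg g w; first by exists (fun _ _ => 0), (fun=> 0).
rewrite big_ord_recr /= => E.
have [|c [w' gk]] := reg k (ltnSn k) (g k).
  exists (fun l => - g l), w; rewrite -E addrA.
  rewrite -big_split big1 ?add0r //= => l _.
  by rewrite mulNr addNr.
(* As [g k] is the sum of the [c l * q l] plus [d * w'], the term [g k * q k] is absorbed by adding
   [c j * q k] to the earlier coefficients and correcting [w]. *)
have [|V [v HV]] := IH (fun i ik => reg i (ltnW ik))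
                       (fun j => g j + c j * q k) (w - w' * q k).
  under eq_bigr do rewrite mulrDl mulrAC.
  rewrite big_split -mulr_suml mulrBr /= -E gk.
  by rewrite mulrDl; ring.
(* The new row [k] is [c] and the new column [k] is zero, so skewing yields [c l] in row [k] and
   [- c j] in column [k]. *)
exists (fun j l => if j == k then (if l == k then 0 else c l)
                   else if l == k then 0 else V j l).
exists (fun j => if j == k then w' else v j) => j.
rewrite ltnS leq_eqVlt big_ord_recr /= eqxx; case: (j =P k) => [-> _ | /eqP jk /= lt_jk].
  rewrite subrr mul0r addr0 gk; congr (_ + _); apply: eq_bigr => l _.
  by rewrite (ltn_eqF (ltn_ord l)) subr0.
have -> : g j = (g j + c j * q k) - c j * q k by rewrite addrK.
rewrite (HV j lt_jk) sub0r mulNr addrAC; congr (_ - _ + _).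
by apply: eq_bigr => l _; rewrite (ltn_eqF (ltn_ord l)).
Qed.

End Koszul.

(** * Gradings of the group ring and cancellation modulo an initial ideal *)

Section Regularity.
Variables (n D : nat) (chi : {additive lat n -> int}) (q : nat -> ZL n).
Implicit Types (f g : ZL n).

Lemma restr_nat_mul (P : pred (lat n)) (f : ZL n) : restr P (D%:R * f) = D%:R * restr P f.
Proof. by rewrite !mulr_natl raddfMn. Qed.

(** The generators have degree [0] for [chi], so taking a homogeneous component only affects the
    coefficients. *)
Lemma in_initial_restr k m g :
  (forall l, (l < k)%N -> supp_in (fun mu => chi mu = 0) (q l)) ->
  in_initial D%:R q k g -> in_initial D%:R q k (restr (fun mu => chi mu == m) g).
Proof.
move=> q0 [c [w ->]]; exists (fun l => restr (fun mu => chi mu == m) (c l)).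
exists (restr (fun mu => chi mu == m) w).
rewrite raddfD /= restr_nat_mul raddf_sum; congr (_ + _); apply: eq_bigr => l _ /=.
apply: restrM; apply: supp_inW (q0 l (ltn_ord l)) => mu mu0 nu.
by rewrite raddfD /= mu0 addr0.
Qed.

(** Degrees add, so a product involving a term above the lowest degree of either factor lands above
    [m + k]. *)
Lemma restr_lowest_mul m k f g :
  supp_in (fun mu => m <= chi mu) f -> supp_in (fun mu => k <= chi mu) g ->
  restr (fun mu => chi mu == m + k) (f * g) =
  restr (fun mu => chi mu == m) f * restr (fun mu => chi mu == k) g.
Proof.
move=> lf lg; pose Pm mu := chi mu == m; pose Pk mu := chi mu == k.
have strict (h : ZL n) (z : int) : supp_in (fun mu => z <= chi mu) h ->
    supp_in (fun mu => z < chi mu) (restr (predC (fun mu => chi mu == z)) h).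
  move=> lh mu; rewrite mcoeff_restr /=; case: ifP => [ne /lh|]; last by rewrite eqxx.
  by rewrite lt_def ne => ->.
have Ef : f = restr Pm f + restr (predC Pm) f by rewrite restrC addrC subrK.
have Eg : g = restr Pk g + restr (predC Pk) g by rewrite restrC addrC subrK.
rewrite [in LHS]Eg mulrDr raddfD /= [X in _ + X](_ : _ = 0) ?addr0.
  rewrite [in LHS]Ef mulrDl raddfD /= [X in _ + X](_ : _ = 0) ?addr0.
    apply: restr_id; apply: supp_inM (@supp_restr _ _ _ _) (@supp_restr _ _ _ _).
    by move=> mu nu /eqP <- /eqP <-; rewrite raddfD.
  apply: restr_eq0; apply: supp_inM (strict _ _ lf) (@supp_restr _ _ _ _).
  by move=> mu nu ? /eqP ?; rewrite raddfD; apply/negP; rewrite gt_eqF //; lia.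
apply: restr_eq0; apply: supp_inM lf (strict _ _ lg) => mu nu ? ?.
by rewrite raddfD; apply/negP; rewrite gt_eqF //; lia.
Qed.

(* The ideal is graded by [chi] and the lowest component of [p] is a unit, so
   the lowest component of [g] can be split off. *)
Lemma in_initial_cancel i (p g : ZL n) (k : int) (nu : lat n) :
  (forall l, (l < i)%N -> supp_in (fun mu => chi mu = 0) (q l)) ->
  supp_in (fun mu => k <= chi mu) p -> restr (fun mu => chi mu == k) p = ex nu ->
  in_initial D%:R q i (g * p) -> in_initial D%:R q i g.
Proof.
move=> q0 lp pk gp.
(* The induction is on the width [N] of an interval containing the degrees of [g]; the sum of all
   their absolute values gives a crude first interval. *)
have [N [m lg]] : exists (N : nat) m, supp_in (fun mu => m <= chi mu < m + N%:Z) g.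
  pose S := (\sum_(mu <- msupp g) `|chi mu|%N)%N.
  exists (2 * S + 1)%N, (- S%:Z) => mu; rewrite mcoeff_neq0 => mug.
  have : (`|chi mu| <= S)%N by rewrite /S (big_fsetD1 mu mug) leq_addr.
  lia.
elim: N m g lg gp => [|N IH] m g lg gp.
  have -> : g = 0.
    apply/malgP => mu; rewrite mcoeff0; apply/eqP/negPn/negP => /lg; lia.
  exact: in_initial0.
pose g0 := restr (fun mu => chi mu == m) g.
have g0J : in_initial D%:R q i g0.
  have := in_initial_restr (m + k) q0 gp.
  rewrite restr_lowest_mul // => [|mu /lg]; last by lia.
  by rewrite pk mulrC => /(in_initialMl (ex (- nu))); rewrite exNK.
have g1J : in_initial D%:R q i ((g - g0) * p).
  rewrite mulrBl -mulrN [_ * - p]mulrC.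
  by apply: in_initialD => //; apply: in_initialMl.
rewrite -(subrK g0 g); apply: in_initialD => //; apply: (IH (m + 1)) => // mu.
rewrite -restrC mcoeff_restr /=; case: ifP => [ne /lg|]; last by rewrite eqxx.
by move/eqP: ne; lia.
Qed.

End Regularity.

(** * From flatness to Koszul syzygies *)

Section Flatness.
Variables (n D : nat).

Definition coord (X : 'M[int]_n) (i : 'I_n) (mu : lat n) : int := (mu *m invmx X) 0 i.

Fact coord_is_additive X i : zmod_morphism (coord X i).
Proof. by move=> mu nu; rewrite /coord mulmxBl !mxE. Qed.
HB.instance Definition _ X i :=
  GRing.isZmodMorphism.Build (lat n) int (coord X i) (coord_is_additive X i).

(** This translates the coefficients in the definition of a divisor into components of the grading
    by [coord X i], up to a unit. *)
Lemma xcoefE X (i : 'I_n) p (j : int) :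
  restr (fun mu => coord X i mu == j) p = ex (j *: row i X) * xcoef X i p j.
Proof.
rewrite restrE /xcoef mulr_sumr; apply: eq_bigr => mu _.
by rewrite grpalgUM mul1r addrC subrK.
Qed.

(** Grade by the [i]-th coordinate: the earlier [q l] lie over the span of earlier basis vectors, so
    in degree [0], and the monic lowest coefficient makes the lowest component of [q i] a single
    group element, hence a unit. *)
Lemma flatness_regular X (q : nat -> ZL n) :
  flatness X (fun i : 'I_n => q i) ->
  forall i, (i < n)%N -> forall g,
    in_initial D%:R q i (g * q i) -> in_initial D%:R q i g.
Proof.
move=> flat i lt_in g.
have [_ [k [low [nu [_ Enu]]]]] := flat (Ordinal lt_in).
apply: (@in_initial_cancel _ _ (coord X (Ordinal lt_in)) _ _ _ _ k
          (k *: row (Ordinal lt_in) X + nu)).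
- move=> l lt_li mu; rewrite mcoeff_neq0 => mul.
  have [/(_ mu mul) span _] := flat (Ordinal (ltn_trans lt_li lt_in)).
  exact: (span (Ordinal lt_in)).
- move=> mu mu0; rewrite leNgt; apply/negP => /low xc0.
  have := xcoefE X (Ordinal lt_in) (q i) (coord X (Ordinal lt_in) mu).
  rewrite xc0 mulr0 => /malgP/(_ mu); rewrite mcoeff_restr eqxx mcoeff0 => E.
  by rewrite E eqxx in mu0.
- by rewrite xcoefE Enu exM.
Qed.

(** An invertible change of generators preserves Koszul syzygies: the skew matrix [W - W^T] turns
    into [A (W - W^T) A^T], again skew. *)
Lemma gen_flatness_koszul (q : 'I_n -> ZL n) (g : 'cV[ZL n]_n) w :
  gen_flatness q -> (\row_i q i) *m g = (D%:R * w)%:M ->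
  exists (V : 'M[ZL n]_n) (v : 'cV[ZL n]_n),
    g = (V - V^T) *m (\col_i q i) + D%:R *: v.
Proof.
move=> [X [_ [A [B [AB BA flat]]]]] gq.
pose r := (\row_i q i) *m A; pose g' := B *m g.
(* [koszul_syzygy] takes families indexed by [nat]; the value [0] beyond [n] is never reached. *)
pose rn (j : nat) := if insub j is Some i then r 0 i else 0.
pose gn (j : nat) := if insub j is Some i then g' i 0 else 0.
have rnE (i : 'I_n) : rn i = r 0 i by rewrite /rn valK.
have gnE (i : 'I_n) : gn i = g' i 0 by rewrite /gn valK.
have flat' : flatness X (fun i : 'I_n => rn i).
  by move=> i; rewrite rnE; apply: flat.
have E : \sum_(j < n) gn j * rn j = D%:R * w.
  have := gq; rewrite -[X in X *m g]mulmx1 -AB mulmxA -mulmxA => /matrixP/(_ 0 0).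
  rewrite !mxE eqxx mulr1n => <-; apply: eq_bigr => i _.
  by rewrite rnE gnE mulrC.
have [V [v HV]] := koszul_syzygy (flatness_regular flat') E.
pose W : 'M[ZL n]_n := \matrix_(i, j) V i j.
exists (A *m W *m A^T), (A *m \col_i v i).
have -> : g = A *m g' by rewrite mulmxA AB mul1mx.
have -> : g' = (W - W^T) *m r^T + D%:R *: \col_i v i.
  apply/colP => i; rewrite -gnE HV // !mxE; congr (_ + _).
  by apply: eq_bigr => j _; rewrite [r^T j 0]mxE -rnE !mxE.
rewrite mulmxDr scalemxAr; congr (_ + _).
have -> : r^T = A^T *m \col_i q i.
  by rewrite /r trmx_mul; congr (_ *m _); apply/colP => i; rewrite !mxE.
by rewrite !trmx_mul trmxK !mulmxA mulmxBr mulmxBl.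
Qed.

End Flatness.

(** * Invariants of the Weyl group *)

Section RootSystem.
Context (n : nat) (C : 'M[int]_n) (d : 'I_n -> int).
Hypothesis Cii : forall i, C i i = 2.
Hypothesis Cij_le0 : forall i j, i != j -> C i j <= 0.
Hypothesis d_gt0 : forall i, 0 < d i.
Hypothesis Cd_sym : forall i j, C i j * d j = C j i * d i.
Hypothesis Cd_posdef : forall x : 'I_n -> rat, (exists i, x i != 0) ->
  0 < \sum_i \sum_j x i * (C i j * d j)%:~R * x j.
Implicit Types (l mu nu lam : lat n) (x y : 'rV[rat]_n) (i j : 'I_n).

(** * The invariant bilinear form and finiteness of orbits *)

Let CQ : 'M[rat]_n := map_mx intr C.
Let S : 'M[rat]_n := \matrix_(i, j) (C i j * d j)%:~R.

(** The invariant inner product in simple-root coordinates, [d j] being half the squared length of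
    [alpha_j]. *)
Definition bform x y : rat := (x *m S *m y^T) 0 0.

Lemma bform_sym x y : bform x y = bform y x.
Proof.
rewrite /bform -[in RHS](trmxK (y *m S *m x^T)) [RHS]mxE !trmx_mul trmxK mulmxA.
by congr ((_ *m _ *m _) _ _); apply/matrixP => i j; rewrite !mxE Cd_sym.
Qed.

Lemma bformDl x y z : bform (x + y) z = bform x z + bform y z.
Proof. by rewrite /bform !mulmxDl mxE. Qed.

Lemma bformZl a x y : bform (a *: x) y = a * bform x y.
Proof. by rewrite /bform -!scalemxAl mxE. Qed.

Lemma bformDr x y z : bform x (y + z) = bform x y + bform x z.
Proof. by rewrite bform_sym bformDl !(bform_sym _ x). Qed.

Lemma bformZr a x y : bform x (a *: y) = a * bform x y.
Proof. by rewrite bform_sym bformZl bform_sym. Qed.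

Lemma bform_gt0 x : x != 0 -> 0 < bform x x.
Proof.
move=> x0.
have -> : bform x x = \sum_i \sum_j x 0 i * (C i j * d j)%:~R * x 0 j.
  rewrite /bform mxE exchange_big /=; apply: eq_bigr => j _; rewrite !mxE mulr_suml.
  by apply: eq_bigr => k _; rewrite !mxE.
apply: Cd_posdef; apply/existsP; apply: contraNT x0 => /existsPn h.
by apply/eqP/rowP => i; rewrite mxE; apply/eqP; move: (h i); rewrite negbK.
Qed.

Lemma bform_ge0 x : 0 <= bform x x.
Proof.
have [->|/bform_gt0/ltW//] := eqVneq x 0.
by rewrite /bform mul0mx mul0mx mxE.
Qed.

Lemma bform_delta x j : bform x (delta_mx 0 j) = (x *m CQ) 0 j * (d j)%:~R.
Proof.
rewrite /bform trmx_delta -colE !mxE mulr_suml; apply: eq_bigr => i _.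
by rewrite !mxE intrM mulrA.
Qed.

Lemma delta_CQ i : delta_mx 0 i *m CQ = map_mx intr (row i C).
Proof. by rewrite -rowE map_row. Qed.

(** A nonzero row vector killed by [C] would be isotropic, against positive definiteness. *)
Lemma CQ_unit : CQ \in unitmx.
Proof.
rewrite -row_free_unit -kermx_eq0; apply/rowV0P => x /sub_kermxP xC.
apply/eqP; apply: contraT => /bform_gt0.
suff -> : bform x x = 0 by rewrite ltxx.
rewrite /bform; have -> : S = CQ *m diag_mx (\row_j (d j)%:~R).
  by apply/matrixP => i j; rewrite mul_mx_diag !mxE intrM.
by rewrite mulmxA xC !mul0mx mxE.
Qed.

(** Coordinates in the basis of simple roots, which are the rows of [C]; they are rational because a
    weight need not lie in the root lattice. *)
Definition root_coord l : 'rV[rat]_n := map_mx intr l *m invmx CQ.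

Lemma root_coordK l : root_coord l *m CQ = map_mx intr l.
Proof. by rewrite mulmxKV ?CQ_unit. Qed.

Lemma root_coord_mul (z : 'rV[int]_n) : root_coord (z *m C) = map_mx intr z.
Proof. by rewrite /root_coord map_mxM mulmxK ?CQ_unit. Qed.

Lemma root_coordD l mu : root_coord (l + mu) = root_coord l + root_coord mu.
Proof. by rewrite /root_coord map_mxD mulmxDl. Qed.

Lemma root_coord_refl i l :
  root_coord (refl C i l) = root_coord l - (l 0 i)%:~R *: delta_mx 0 i.
Proof.
rewrite /root_coord /refl map_mxB map_mxZ mulmxBl -scalemxAl -delta_CQ.
by rewrite mulmxK ?CQ_unit.
Qed.

Lemma bform_root_coord l j :
  bform (root_coord l) (delta_mx 0 j) = (l 0 j)%:~R * (d j)%:~R.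
Proof. by rewrite bform_delta root_coordK mxE. Qed.

Lemma bform_delta_delta i j : bform (delta_mx 0 i) (delta_mx 0 j) = (C i j)%:~R * (d j)%:~R.
Proof. by rewrite bform_delta delta_CQ !mxE. Qed.

Definition normsq l : rat := bform (root_coord l) (root_coord l).

Lemma bform_shift l j (t : rat) :
  let x := root_coord l + t *: delta_mx 0 j in
  bform x x = normsq l + (d j)%:~R * (2 * t * (l 0 j)%:~R + 2 * t ^+ 2).
Proof.
rewrite /= /normsq !(bformDl, bformDr, bformZl, bformZr) bform_delta_delta.
rewrite [bform (delta_mx 0 j) _]bform_sym !bform_root_coord Cii; ring.
Qed.

Lemma normsq_refl i l : normsq (refl C i l) = normsq l.
Proof.
rewrite {1}/normsq root_coord_refl -scaleNr bform_shift; ring.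
Qed.

(** Shifting by [- l_j / 2] along [alpha_j] minimizes the form on that line; nonnegativity there
    reads [d_j * l_j^2 <= 2 * normsq l], and [d_j] and [l_j] are integers. *)
Lemma coord_le_normsq l j : `|l 0 j|%:~R <= 2 * normsq l.
Proof.
have := bform_ge0 (root_coord l + (- (l 0 j)%:~R / 2) *: delta_mx 0 j).
rewrite bform_shift => le0.
have d1 : 1 <= (d j)%:~R :> rat by rewrite ler1z; have := d_gt0 j; lia.
have le1 : `|l 0 j|%:~R <= (l 0 j)%:~R ^+ 2 :> rat.
  by rewrite -rmorphXn ler_int; nia.
have sq0 : 0 <= (l 0 j)%:~R ^+ 2 :> rat by apply: sqr_ge0.
move: le0 d1 le1 sq0; set a := (l 0 j)%:~R; set D := (d j)%:~R; nra.
Qed.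

Lemma finite_normsq (c : rat) :
  exists B : {fset lat n}, forall l, normsq l <= c -> l \in B.
Proof.
pose N := Num.bound (2 * c).
pose F (f : {ffun 'I_n -> 'I_(2 * N + 1)}) : lat n := \row_j ((f j : nat)%:Z - N%:Z).
exists (seq_fset tt (codom F)) => l le_c; rewrite seq_fsetE.
have lN j : (`|(l 0 j)%R| < N)%N.
  have c0 : 0 <= 2 * c by rewrite mulr_ge0 // (le_trans _ le_c) // bform_ge0.
  have : `|l 0 j|%:~R < N%:Z%:~R :> rat.
    apply: le_lt_trans (coord_le_normsq l j) (le_lt_trans _ (archi_boundP c0)).
    by rewrite ler_pM2l.
  by rewrite ltr_int; lia.
have bnd j : (`|(l 0 j + N%:Z)%R| < 2 * N + 1)%N by have := lN j; lia.
apply/codomP; exists [ffun j => Ordinal (bnd j)]; apply/rowP => j.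
by rewrite !mxE ffunE /=; have := lN j; lia.
Qed.

Lemma reflK i l : refl C i (refl C i l) = l.
Proof.
rewrite /refl !mxE Cii; apply/rowP => j; rewrite !mxE; ring.
Qed.

Lemma weyl_act_ind (P : lat n -> Prop) l :
  P l -> (forall i mu, P mu -> P (refl C i mu)) -> forall mu, in_orbit C l mu -> P mu.
Proof. by move=> Pl Pr mu [w ->]; elim: w => //= i w IH; apply: Pr. Qed.

Lemma in_orbit_refl l mu i : in_orbit C l mu -> in_orbit C l (refl C i mu).
Proof. by move=> [w ->]; exists (i :: w). Qed.

(** [orbit] is chosen by [epsilon], so a finite set with the right elements must be exhibited; it
    exists because [normsq] is constant on an orbit. *)
Lemma orbitP l mu : mu \in orbit C l <-> in_orbit C l mu.
Proof.
pose P (A : {fset lat n}) := forall mu, mu \in A <-> in_orbit C l mu.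
have : exists A, P A.
  have [B HB] := finite_normsq (normsq l).
  pose p nu : bool := if excluded_middle_informative (in_orbit C l nu) then true else false.
  exists [fset nu in B | p nu] => nu; rewrite !inE /= /p.
  case: excluded_middle_informative => H; rewrite ?andbT ?andbF; split=> // _.
  by apply: HB; elim/weyl_act_ind: H => // i nu'; rewrite normsq_refl.
by move=> /(epsilon_spec (inhabits fset0)) /(_ mu).
Qed.

(** * Height, ascents and dominant weights *)

Definition height l : rat := \sum_i root_coord l 0 i.

Lemma heightD l mu : height (l + mu) = height l + height mu.
Proof.
by rewrite /height root_coordD -big_split; apply: eq_bigr => i _; rewrite !mxE.
Qed.

Lemma height_mul (z : 'rV[int]_n) : height (z *m C) = \sum_i (z 0 i)%:~R.
Proof. by rewrite /height root_coord_mul; apply: eq_bigr => i _; rewrite mxE. Qed.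

Lemma height_refl i l : height (refl C i l) = height l - (l 0 i)%:~R.
Proof.
rewrite /refl heightD rowE scalemxAl -mulNmx height_mul; congr (_ + _).
rewrite (bigD1 i) //= big1 ?addr0; first by rewrite !mxE !eqxx mulr1 intrN.
by move=> j ji; rewrite !mxE eqxx (negPf ji) andbF mulr0 oppr0.
Qed.

Definition dominant l := forall i, 0 <= l 0 i.

Inductive ascends : lat n -> lat n -> Prop :=
| ascends_refl l : ascends l l
| ascends_step i l lam : l 0 i < 0 -> ascends (refl C i l) lam -> ascends l lam.

(** Ascents terminate: each raises [height] and keeps [normsq], so among the finitely many weights
    of bounded norm fewer and fewer are higher. *)
Lemma ascent_ind (P : lat n -> Prop) :
  (forall l, (forall i, l 0 i < 0 -> P (refl C i l)) -> P l) -> forall l, P l.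
Proof.
move=> IH l0; have [B HB] := finite_normsq (normsq l0).
suff H k l : normsq l = normsq l0 ->
    (#|` [fset mu in B | (height l < height mu)%R]| < k)%N -> P l.
  exact: (H _ _ erefl (ltnSn _)).
elim: k l => // k IHk l nl; rewrite ltnS => lek; apply: IH => i li.
apply: IHk; first by rewrite normsq_refl.
have lt_h : height l < height (refl C i l).
  by rewrite height_refl ltrDl oppr_gt0 ltrz0.
apply: leq_trans lek; apply: fproper_ltn_card; rewrite fproperE; apply/andP; split.
  by apply/fsubsetP => mu; rewrite !inE => /andP[-> /(lt_trans lt_h)].
apply/fsubsetPn; exists (refl C i l); rewrite !inE ?ltxx ?andbF //= lt_h andbT.
by apply: HB; rewrite normsq_refl nl.
Qed.

Lemma ascends_dominant l : exists2 lam, ascends l lam & dominant lam.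
Proof.
elim/ascent_ind: l => l IH.
case: (boolP [exists i, l 0 i < 0]) => [/existsP[i li]|/existsPn h].
  by have [lam ? ?] := IH i li; exists lam => //; apply: ascends_step li _.
by exists l; [apply: ascends_refl|move=> i; rewrite leNgt].
Qed.

Lemma Cij_eq0 i j : C i j = 0 -> C j i = 0.
Proof.
move=> Cij; have /esym/eqP := Cd_sym i j.
by rewrite Cij mul0r mulf_eq0 (gt_eqF (d_gt0 i)) orbF => /eqP.
Qed.

(** The form at [C j i * alpha_i - 2 * alpha_j] equals [2 * d j * (4 - C i j * C j i)] and is
    positive. *)
Lemma Cij_Cji_lt4 i j : i != j -> C i j * C j i < 4.
Proof.
move=> ij; pose x : 'rV[rat]_n := (C j i)%:~R *: delta_mx 0 i - 2 *: delta_mx 0 j.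
have x0 : x != 0.
  apply/eqP => /rowP/(_ j); rewrite !mxE !eqxx [j == i]eq_sym (negPf ij) /=.
  by rewrite mulr0 mulr1 add0r.
have := bform_gt0 x0.
rewrite /x -scaleNr !(bformDl, bformDr, bformZl, bformZr) !bform_delta_delta !Cii.
set E := (X in 0 < X).
have -> : E = (2 * C j i ^+ 2 * d i - 2 * C j i * (C i j * d j)
               - 2 * C j i * (C j i * d i) + 8 * d j)%:~R.
  by rewrite /E !(rmorphB, rmorphD, rmorphM) /=; ring.
rewrite ltr0z; have := Cd_sym i j; have := d_gt0 i; have := d_gt0 j; nia.
Qed.

(** * Local confluence of ascents in rank two *)

Section RankTwo.
Variables (i j : 'I_n) (nu : lat n).
(** Both reflections preserve this coset of the rank two root lattice, and each changes only one of
    [p] and [q], affinely. *)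
Let pt (p q : int) : lat n := nu + p *: row i C + q *: row j C.

Lemma ascends_stepl (p q : int) lam :
  nu 0 i + 2 * p + C j i * q < 0 -> ascends (pt (- nu 0 i - p - C j i * q) q) lam ->
  ascends (pt p q) lam.
Proof.
move=> lt0 asc; apply: (@ascends_step i).
  by suff -> : pt p q 0 i = nu 0 i + 2 * p + C j i * q by []; rewrite !mxE Cii; ring.
suff -> : refl C i (pt p q) = pt (- nu 0 i - p - C j i * q) q by [].
by apply/rowP => k; rewrite !mxE Cii; ring.
Qed.

Lemma ascends_stepr (p q : int) lam :
  nu 0 j + 2 * q + C i j * p < 0 -> ascends (pt p (- nu 0 j - q - C i j * p)) lam ->
  ascends (pt p q) lam.
Proof.
move=> lt0 asc; apply: (@ascends_step j).
  by suff -> : pt p q 0 j = nu 0 j + 2 * q + C i j * p by []; rewrite !mxE Cii; ring.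
suff -> : refl C j (pt p q) = pt p (- nu 0 j - q - C i j * p) by [].
by apply/rowP => k; rewrite !mxE Cii; ring.
Qed.

Lemma refl_ptl : refl C i nu = pt (- nu 0 i) 0.
Proof. by rewrite /refl /pt scale0r addr0 scaleNr. Qed.

Lemma refl_ptr : refl C j nu = pt 0 (- nu 0 j).
Proof. by rewrite /refl /pt scale0r addr0 scaleNr. Qed.

Lemma pt_eq p q p' q' : p = p' -> q = q' -> ascends (pt p q) (pt p' q').
Proof. by move=> -> ->; apply: ascends_refl. Qed.

(** The entries are nonpositive, vanish together and have product below [4]. This leaves A1 x A1,
    A2, and B2 and G2 in two orientations each. *)
Lemma cartan_pair_cases : i != j ->
  [\/ C i j = 0 /\ C j i = 0, C i j = -1 /\ C j i = -1,
      C i j = -1 /\ C j i = -2 | C i j = -2 /\ C j i = -1] \/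
  (C i j = -1 /\ C j i = -3) \/ (C i j = -3 /\ C j i = -1).
Proof.
move=> ij; have := Cij_Cji_lt4 ij; have := Cij_le0 ij.
have ji : j != i by rewrite eq_sym.
have := Cij_le0 ji; have := @Cij_eq0 i j; have := @Cij_eq0 j i.
move: (C i j) (C j i) => a b h1 h2 b0 a0 ab.
have [ea|na] := eqVneq a 0; first by left; constructor 1; split=> //; apply: h2.
have [eb|nb] := eqVneq b 0; first by left; constructor 1; split=> //; apply: h1.
have a3 : -3 <= a by nia.
have b3 : -3 <= b by nia.
have Ha : a = -1 \/ a = -2 \/ a = -3 by lia.
have Hb : b = -1 \/ b = -2 \/ b = -3 by lia.
by case: Ha Hb ab => [|[]] -> [|[]] -> // _;
  do ?[by left; constructor | by right; left | by right; right].
Qed.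

(* The longest element of the rank two Weyl group, reached by its two reduced
   words; every step is an ascent because [nu] is strictly antidominant for it. *)
Lemma ascends_diamond : i != j -> nu 0 i < 0 -> nu 0 j < 0 ->
  exists2 tau, ascends (refl C i nu) tau & ascends (refl C j nu) tau.
Proof.
move=> ij i0 j0; rewrite refl_ptl refl_ptr.
set s := nu 0 i in i0 *; set t := nu 0 j in j0 *.
case: (cartan_pair_cases ij) => [[]|[]] [Cij Cji].
- exists (pt (- s) (- t)).
    apply: ascends_stepr; rewrite ?Cij ?Cji; first by lia.
    by apply: pt_eq; lia.
  apply: ascends_stepl; rewrite ?Cij ?Cji; first by lia.
  by apply: pt_eq; lia.
- exists (pt (- s - t) (- s - t)).
    apply: ascends_stepr; rewrite ?Cij ?Cji; first by lia.
    apply: ascends_stepl; rewrite ?Cij ?Cji; first by lia.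
    by apply: pt_eq; lia.
  apply: ascends_stepl; rewrite ?Cij ?Cji; first by lia.
  apply: ascends_stepr; rewrite ?Cij ?Cji; first by lia.
  by apply: pt_eq; lia.
- exists (pt (- 2 * s - 2 * t) (- s - 2 * t)).
    apply: ascends_stepr; rewrite ?Cij ?Cji; first by lia.
    apply: ascends_stepl; rewrite ?Cij ?Cji; first by lia.
    apply: ascends_stepr; rewrite ?Cij ?Cji; first by lia.
    by apply: pt_eq; lia.
  apply: ascends_stepl; rewrite ?Cij ?Cji; first by lia.
  apply: ascends_stepr; rewrite ?Cij ?Cji; first by lia.
  apply: ascends_stepl; rewrite ?Cij ?Cji; first by lia.
  by apply: pt_eq; lia.
- exists (pt (- 2 * s - t) (- 2 * s - 2 * t)).
    apply: ascends_stepr; rewrite ?Cij ?Cji; first by lia.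
    apply: ascends_stepl; rewrite ?Cij ?Cji; first by lia.
    apply: ascends_stepr; rewrite ?Cij ?Cji; first by lia.
    by apply: pt_eq; lia.
  apply: ascends_stepl; rewrite ?Cij ?Cji; first by lia.
  apply: ascends_stepr; rewrite ?Cij ?Cji; first by lia.
  apply: ascends_stepl; rewrite ?Cij ?Cji; first by lia.
  by apply: pt_eq; lia.
- exists (pt (- 4 * s - 6 * t) (- 2 * s - 4 * t)).
    apply: ascends_stepr; rewrite ?Cij ?Cji; first by lia.
    apply: ascends_stepl; rewrite ?Cij ?Cji; first by lia.
    apply: ascends_stepr; rewrite ?Cij ?Cji; first by lia.
    apply: ascends_stepl; rewrite ?Cij ?Cji; first by lia.
    apply: ascends_stepr; rewrite ?Cij ?Cji; first by lia.
    by apply: pt_eq; lia.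
  apply: ascends_stepl; rewrite ?Cij ?Cji; first by lia.
  apply: ascends_stepr; rewrite ?Cij ?Cji; first by lia.
  apply: ascends_stepl; rewrite ?Cij ?Cji; first by lia.
  apply: ascends_stepr; rewrite ?Cij ?Cji; first by lia.
  apply: ascends_stepl; rewrite ?Cij ?Cji; first by lia.
  by apply: pt_eq; lia.
- exists (pt (- 4 * s - 2 * t) (- 6 * s - 4 * t)).
    apply: ascends_stepr; rewrite ?Cij ?Cji; first by lia.
    apply: ascends_stepl; rewrite ?Cij ?Cji; first by lia.
    apply: ascends_stepr; rewrite ?Cij ?Cji; first by lia.
    apply: ascends_stepl; rewrite ?Cij ?Cji; first by lia.
    apply: ascends_stepr; rewrite ?Cij ?Cji; first by lia.
    by apply: pt_eq; lia.
  apply: ascends_stepl; rewrite ?Cij ?Cji; first by lia.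
  apply: ascends_stepr; rewrite ?Cij ?Cji; first by lia.
  apply: ascends_stepl; rewrite ?Cij ?Cji; first by lia.
  apply: ascends_stepr; rewrite ?Cij ?Cji; first by lia.
  apply: ascends_stepl; rewrite ?Cij ?Cji; first by lia.
  by apply: pt_eq; lia.
Qed.

End RankTwo.

(** The argument of Newman's lemma: distinct first steps meet in some [tau], and a dominant weight
    above [tau] is compared with [lam] and [lam'] by induction. *)
Lemma ascends_unique l lam lam' :
  ascends l lam -> ascends l lam' -> dominant lam -> dominant lam' -> lam = lam'.
Proof.
elim/ascent_ind: l lam lam' => l IH lam lam' asc asc' dom dom'.
case: asc dom IH asc' => [{}l|i {}l {}lam li asc] dom IH asc'.
  by case: asc' dom => // i l' lam'' li _ /(_ i); rewrite leNgt li.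
case: asc' dom' li asc IH => [{}l|j {}l {}lam' lj asc'] dom' li asc IH.
  by move: (dom' i); rewrite leNgt li.
have [ij|ij] := eqVneq i j.
  by apply: (IH i li) => //; rewrite ij.
have [tau t1 t2] := ascends_diamond ij li lj.
have [sig tsig doms] := ascends_dominant tau.
have asc_trans a b c : ascends a b -> ascends b c -> ascends a c.
  by elim=> // k u v uk _ IHa /IHa; apply: ascends_step.
rewrite (IH i li lam sig) //; last exact: asc_trans tsig.
by apply/esym; apply: (IH j lj) => //; apply: asc_trans tsig.
Qed.

(** Follow one reflection of [nu]: if it ascends, uniqueness brings its dominant weight back to
    [lam]; if it descends, one ascent returns to [nu]; otherwise [nu] is fixed. *)
Lemma orbit_ascends lam mu : dominant lam -> in_orbit C lam mu -> ascends mu lam.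
Proof.
move=> dom; elim/weyl_act_ind => [|i nu asc]; first exact: ascends_refl.
case: (ltgtP (nu 0 i) 0) => nui.
- have [sig a1 ds] := ascends_dominant (refl C i nu).
  by rewrite -(ascends_unique (ascends_step nui a1) asc ds dom).
- apply: (@ascends_step i); last by rewrite reflK.
  suff -> : refl C i nu 0 i = - nu 0 i by rewrite oppr_lt0.
  by rewrite !mxE Cii; ring.
- by rewrite /refl nui scale0r subr0.
Qed.

(** * The strict dominance order and leading terms *)

Definition below nu lam :=
  exists z : 'rV[int]_n, [/\ forall i, 0 <= z 0 i, z != 0 & lam = nu + z *m C].

Lemma nonneg_add_neq0 (z z' : 'rV[int]_n) :
  (forall i, 0 <= z 0 i) -> (forall i, 0 <= z' 0 i) -> z != 0 -> z + z' != 0.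
Proof.
move=> z0 z0'; apply: contra_neq => /rowP E; apply/rowP => i.
by move/eqP: (E i); rewrite !mxE paddr_eq0 // => /andP[/eqP].
Qed.

Lemma belowD nu lam nu' lam' :
  below nu lam -> below nu' lam' -> below (nu + nu') (lam + lam').
Proof.
move=> [z [z0 zn ->]] [z' [z0' _ ->]]; exists (z + z'); split=> [i||].
- by rewrite mxE addr_ge0.
- exact: nonneg_add_neq0.
- by rewrite mulmxDl addrACA.
Qed.

Lemma below_addl mu nu lam : below nu lam -> below (mu + nu) (mu + lam).
Proof. by move=> [z [z0 zn ->]]; exists z; rewrite addrA. Qed.

Lemma below_height nu lam : below nu lam -> height nu < height lam.
Proof.
move=> [z [z0 zn ->]]; rewrite heightD height_mul ltrDl lt_def.
have s0 : 0 <= \sum_i (z 0 i)%:~R :> rat by apply: sumr_ge0 => i _; rewrite ler0z.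
rewrite s0 andbT; apply: contra_neq zn => /eqP.
rewrite psumr_eq0 => [/allP H|i _]; last by rewrite ler0z.
by apply/rowP => i; have := H i (mem_index_enum i); rewrite mxE intr_eq0 => /eqP.
Qed.

Lemma bform_dominant_ge0 l (z : 'rV[int]_n) :
  dominant l -> (forall i, 0 <= z 0 i) -> 0 <= bform (root_coord l) (map_mx intr z).
Proof.
move=> dom z0; rewrite (row_sum_delta (map_mx intr z)).
elim/big_rec: _ => [|i x _ IH]; first by rewrite /bform trmx0 mulmx0 mxE.
rewrite bformDr bformZr bform_root_coord addr_ge0 // mxE !mulr_ge0 ?ler0z //.
exact/ltW.
Qed.

(** With [beta = lam - nu], the squared norms differ by [(nu, beta) + (lam, beta)], and a dominant
    weight pairs nonnegatively with every simple root. *)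
Lemma below_normsq nu lam :
  dominant nu -> dominant lam -> below nu lam -> normsq nu <= normsq lam.
Proof.
move=> dnu dlam [z [z0 _ E]].
have := bform_dominant_ge0 dnu z0; have := bform_dominant_ge0 dlam z0.
rewrite /normsq E root_coordD root_coord_mul !(bformDl, bformDr).
rewrite [bform (map_mx _ _) (root_coord nu)]bform_sym; lra.
Qed.

Lemma ascends_below l lam : ascends l lam -> l = lam \/ below l lam.
Proof.
elim=> [{}l|i {}l {}lam li _ IH]; first by left.
have b : below l (refl C i l).
  exists (- l 0 i *: delta_mx 0 i); split.
  - by move=> j; rewrite !mxE mulr_ge0 ?ler0n // oppr_ge0 ltW.
  - apply: contraTneq li => /rowP/(_ i)/eqP.
    by rewrite !mxE !eqxx mulr1 oppr_eq0 => /eqP ->; rewrite ltxx.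
  - by rewrite -scalemxAl -rowE scaleNr.
right; case: IH => [<- //|[z [z0 zn E]]].
case: b => y [y0 yn E'].
exists (y + z); split=> [j||].
- by rewrite mxE addr_ge0.
- exact: nonneg_add_neq0.
- by rewrite E E' mulmxDl addrA.
Qed.

Definition leading lam (f : ZL n) :=
  exists r, f = ex lam + r /\ supp_in (fun mu => below mu lam) r.

Lemma leading1 : leading 0 1.
Proof. by exists 0; split; [rewrite addr0|apply: supp_in0]. Qed.

Lemma leadingM lam lam' f f' :
  leading lam f -> leading lam' f' -> leading (lam + lam') (f * f').
Proof.
move=> [r [-> Hr]] [r' [-> Hr']].
exists (ex lam * r' + r * ex lam' + r * r'); split.
  by rewrite -exM mulrDl !mulrDr !addrA.
have exl mu : supp_in (fun nu => nu = mu) (ex mu) by apply: supp_inU.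
apply: supp_inD; first apply: supp_inD.
- by apply: supp_inM (exl lam) Hr' => k1 k2 ->; apply: below_addl.
- apply: supp_inM Hr (exl lam') => k1 k2 H ->.
  by rewrite addrC [lam + _]addrC; apply: below_addl.
- by apply: supp_inM Hr Hr' => k1 k2; apply: belowD.
Qed.

Lemma leading_rho lam : dominant lam -> leading lam (rho C lam).
Proof.
move=> dom; have mlam : lam \in orbit C lam by apply/orbitP; exists [::].
exists (\sum_(mu <- orbit C lam `\ lam) ex mu); split.
  by rewrite /rho (big_fsetD1 lam).
rewrite big_seq; apply: supp_in_sum => mu; rewrite !inE => /andP[ne /orbitP mo].
apply: supp_inU; have [E|//] := ascends_below (orbit_ascends dom mo).
by rewrite E eqxx in ne.
Qed.

Lemma leading_coef lam f : leading lam f -> f@_lam = 1.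
Proof.
move=> [r [-> Hr]]; rewrite mcoeffD mcoeffUU.
have [->|/eqP/Hr/below_height] := r@_lam =P 0; first by rewrite addr0.
by rewrite ltxx.
Qed.

Lemma leading_supp lam f : leading lam f -> supp_in (fun mu => mu = lam \/ below mu lam) f.
Proof.
move=> [r [-> Hr]]; apply: supp_inD; first by apply: supp_inU; left.
by apply: supp_inW Hr; right.
Qed.

(** * The action of simple reflections on the group ring *)

Lemma reflD i l mu : refl C i (l + mu) = refl C i l + refl C i mu.
Proof. by rewrite /refl mxE scalerDl opprD addrACA. Qed.

Lemma mcoeff_wact i f mu : (wact C i f)@_mu = f@_(refl C i mu).
Proof.
rewrite /wact raddf_sum /=.
have E nu : (refl C i nu == mu) = (nu == refl C i mu).
  by apply/eqP/eqP => [<-|->]; rewrite reflK.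
under eq_bigr do rewrite mcoeffU E.
case: (msuppP f (refl C i mu)) => muf.
  rewrite (big_fsetD1 _ muf) /= eqxx big_seq big1 ?addr0 // => nu.
  by rewrite !inE => /andP[/negPf -> _].
rewrite big_seq big1 // => nu nuf; case: eqP => // H.
by rewrite -H nuf in muf.
Qed.

Fact wact_is_additive i : zmod_morphism (wact C i).
Proof.
move=> f g; apply/malgP => mu.
apply: etrans (mcoeff_wact i _ mu) _; apply: etrans (mcoeffB _ _ _) _.
by rewrite mcoeffB; congr (_ - _); apply/esym/mcoeff_wact.
Qed.

HB.instance Definition _ i :=
  GRing.isZmodMorphism.Build (ZL n) (ZL n) (wact C i) (wact_is_additive i).

Lemma wactU i c l : wact C i << c *g l >> = << c *g refl C i l >>.
Proof.
apply/malgP => mu; rewrite mcoeff_wact !mcoeffU; congr (_ *+ (_ : bool)).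
by apply/eqP/eqP => [->|<-]; rewrite reflK.
Qed.

Lemma wactM i f g : wact C i (f * g) = wact C i f * wact C i g.
Proof.
elim/grpalg_ind: f => [|c k f IH]; first by rewrite mul0r raddf0 mul0r.
rewrite mulrDl !raddfD /= IH mulrDl; congr (_ + _).
elim/grpalg_ind: g {IH f} => [|c' k' g IH]; first by rewrite mulr0 raddf0 mulr0.
rewrite mulrDr !raddfD /= mulrDr IH grpalgUM; congr (_ + _).
apply: etrans (wactU _ _ _) _; apply/esym.
by apply: etrans (congr2 (@GRing.mul (ZL n)) (wactU _ _ _) (wactU _ _ _)) _; rewrite reflD grpalgUM.
Qed.

Lemma W_invariantP f : W_invariant C f <-> forall i mu, f@_(refl C i mu) = f@_mu.
Proof.
split=> [inv i mu|inv i]; first by rewrite -mcoeff_wact inv.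
by apply/malgP => mu; rewrite mcoeff_wact.
Qed.

Lemma W_invariant1 : W_invariant C 1.
Proof. by move=> i; rewrite -ex0 wactU /refl mxE scale0r subr0. Qed.

Lemma W_invariantM f g : W_invariant C f -> W_invariant C g -> W_invariant C (f * g).
Proof.
move=> If Ig i; apply: etrans (wactM i f g) _.
by congr (_ * _); [exact: If|exact: Ig].
Qed.

Lemma W_invariantB f g : W_invariant C f -> W_invariant C g -> W_invariant C (f - g).
Proof.
move=> If Ig i; apply: etrans (raddfB (wact C i) f g) _ => /=.
by congr (_ - _); [exact: If|exact: Ig].
Qed.

Lemma W_invariantMz f z : W_invariant C f -> W_invariant C (f *~ z).
Proof.
move=> If i; apply: etrans (raddfMz (wact C i) z f) _ => /=.
by congr (_ *~ _); exact: If.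
Qed.

Lemma W_invariant_rho l : W_invariant C (rho C l).
Proof.
apply/W_invariantP => i mu.
have E nu : (rho C l)@_nu = (nu \in orbit C l)%:R.
  rewrite /rho raddf_sum /=; case: (boolP (nu \in _)) => nuo.
    rewrite (big_fsetD1 nu) //= mcoeffUU big_seq big1 ?addr0 // => k.
    by rewrite !inE mcoeffU => /andP[/negPf ->].
  rewrite big_seq big1 // => k ko; rewrite mcoeffU; case: eqP => // H.
  by rewrite -H ko in nuo.
rewrite !E; congr (_ : bool)%:R; apply/idP/idP => /orbitP H; apply/orbitP.
  by rewrite -(reflK i mu); apply: in_orbit_refl.
exact: in_orbit_refl.
Qed.

Lemma augm_rho l : augm (rho C l) = #|` orbit C l|%:R.
Proof.
rewrite /rho raddf_sum /= big_seq (eq_bigr (fun=> 1)) => [|mu _]; last exact: augmU.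
by rewrite -big_seq big_const_seq count_predT iter_addr_0.
Qed.

Lemma ssz_gt0 (j : nat) : (0 < ssz C j)%N.
Proof.
by rewrite cardfs_gt0; apply/fset0Pn; exists (omegan n j); apply/orbitP; exists [::].
Qed.

(** * Generation of the invariant ideal by fundamental orbit sums *)

Definition rho_ideal f := exists F : 'I_n -> ZL n, f = \sum_j F j * rhoj C j.

Lemma rho_ideal0 : rho_ideal 0.
Proof. by exists (fun=> 0); rewrite big1 // => j _; rewrite mul0r. Qed.

Lemma rho_idealD f g : rho_ideal f -> rho_ideal g -> rho_ideal (f + g).
Proof.
move=> [F ->] [G ->]; exists (fun j => F j + G j).
by rewrite -big_split; apply: eq_bigr => j _; rewrite mulrDl.
Qed.

Lemma rho_idealMl h f : rho_ideal f -> rho_ideal (h * f).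
Proof.
move=> [F ->]; exists (fun j => h * F j).
by rewrite mulr_sumr; apply: eq_bigr => j _; rewrite mulrA.
Qed.

Lemma rho_ideal_gen (j : 'I_n) : rho_ideal (rhoj C j).
Proof.
exists (fun k => (k == j)%:R); rewrite (bigD1 j) //= eqxx mul1r big1 ?addr0 //.
by move=> k /negPf ->; rewrite mul0r.
Qed.

(** For augmentation zero this is membership in [rho_ideal]. Being closed under products, it passes
    from the [rhoo C j] to all polynomials in them. *)
Definition constant_mod f := rho_ideal (f - (augm f)%:~R).

Lemma constant_modM f g : constant_mod f -> constant_mod g -> constant_mod (f * g).
Proof.
move=> Ef Eg; rewrite /constant_mod rmorphM /= intrM.
have -> : f * g - (augm f)%:~R * (augm g)%:~R
   = f * (g - (augm g)%:~R) + (augm g)%:~R * (f - (augm f)%:~R) by ring.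
by apply: rho_idealD; apply: rho_idealMl.
Qed.

Lemma constant_modD f g : constant_mod f -> constant_mod g -> constant_mod (f + g).
Proof.
move=> Ef Eg; rewrite /constant_mod rmorphD /= intrD opprD addrACA.
exact: rho_idealD.
Qed.

Lemma constant_mod_int (z : int) : constant_mod z%:~R.
Proof. by rewrite /constant_mod rmorph_int intz subrr; apply: rho_ideal0. Qed.

Lemma constant_mod_rhoo (j : 'I_n) : constant_mod (rhoo C j).
Proof. by rewrite /constant_mod augm_rho natz -pmulrn; apply: rho_ideal_gen. Qed.

(** Meant for dominant [lam], where the absolute value merely converts a coordinate to a [nat] and
    the leading term is [ex lam]. *)
Definition weight_monomial lam : ZL n := \prod_(j < n) rhoo C j ^+ `|(lam 0 j)%R|%N.

Lemma dominant_omega (j : nat) : dominant (omegan n j).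
Proof. by move=> i; rewrite mxE; case: eqP. Qed.

Lemma leading_weight_monomial lam : dominant lam -> leading lam (weight_monomial lam).
Proof.
move=> dom; have {1}-> : lam = \sum_(j < n) omegan n j *+ `|(lam 0 j)%R|%N.
  apply/rowP => k; rewrite summxE (bigD1 k) //= big1 ?addr0.
    by rewrite mulmxnE mxE eqxx; have := dom k; lia.
  by move=> j jk; rewrite mulmxnE mxE eq_sym (inj_eq val_inj) (negPf jk) mul0rn.
apply: (big_ind2 leading) => [|f lam1 g lam2|j _]; [exact: leading1|exact: leadingM|].
elim: `|_|%N => [|k IH]; first exact: leading1.
by rewrite exprS mulrS; apply: leadingM IH; apply/leading_rho/dominant_omega.
Qed.

Lemma W_invariant_weight_monomial lam : W_invariant C (weight_monomial lam).
Proof.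
apply: big_ind => [||j _]; [exact: W_invariant1|exact: W_invariantM|].
elim: `|_|%N => [|k IH]; first exact: W_invariant1.
by rewrite exprS; apply: W_invariantM IH; apply: W_invariant_rho.
Qed.

Lemma constant_mod_weight_monomial lam : constant_mod (weight_monomial lam).
Proof.
apply: big_ind => [||j _]; [exact: (constant_mod_int 1)|exact: constant_modM|].
elim: `|_|%N => [|k IH]; first exact: (constant_mod_int 1).
by rewrite exprS; apply: constant_modM IH; apply: constant_mod_rhoo.
Qed.

Lemma W_invariant_ascends f l lam : W_invariant C f -> ascends l lam -> f@_l = f@_lam.
Proof.
by move=> /W_invariantP inv; elim=> // i {}l {}lam _ _ <-; rewrite inv.
Qed.

(** Triangular elimination on the size of [B]: a multiple of [weight_monomial mu], with [mu] of
    maximal height in [B], cancels the coefficient at [mu], and its other dominant weights stay in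
    the downward closed set [B]. *)
Lemma W_invariant_constant_mod_on (B : {fset lat n}) f :
  (forall mu, mu \in B -> dominant mu) ->
  (forall nu mu, mu \in B -> dominant nu -> below nu mu -> nu \in B) ->
  W_invariant C f -> supp_in (fun mu => dominant mu -> mu \in B) f -> constant_mod f.
Proof.
have [k] := ubnP #|` B|; elim: k B f => // k IH B f; rewrite ltnS => Bk domB down inv supp.
case: (fset_0Vmem B) => [B0|[b bB]].
  (* An invariant is determined by its coefficients at dominant weights, as every weight ascends to
     one. *)
  suff -> : f = 0 by apply: (constant_mod_int 0).
  apply/malgP => l; rewrite mcoeff0; have [lam asc dom] := ascends_dominant l.
  rewrite (W_invariant_ascends inv asc); apply/eqP/negPn/negP => /supp /(_ dom).
  by rewrite B0.
pose F (x : B) := height (val x).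
case: (arg_maxP (i0 := [` bB]) (P := predT) F) => //= -[mu muB] _ maxh.
have {}maxh nu : nu \in B -> height nu <= height mu by move=> nuB; apply: (maxh [` nuB]).
have lead := leading_weight_monomial (domB mu muB).
pose g := weight_monomial mu *~ f@_mu.
have -> : f = (f - g) + (f@_mu)%:~R * weight_monomial mu by rewrite mulrzl subrK.
apply: constant_modD; last first.
  exact: constant_modM (constant_mod_int _) (constant_mod_weight_monomial _).
apply: (IH (B `\ mu)).
- by move: Bk; rewrite (cardfsD1 mu) muB.
- by move=> nu; rewrite !inE => /andP[_ /domB].
(* Maximality of the height of [mu] keeps [B] downward closed once [mu] is removed. *)
- move=> nu nu'; rewrite !inE => /andP[_ nu'B] dnu bel.
  rewrite (down nu nu') // andbT; apply: contraTneq (below_height bel) => ->.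
  by rewrite -leNgt maxh.
- apply: W_invariantB inv _; apply: W_invariantMz.
  exact: W_invariant_weight_monomial.
- move=> nu fg dnu; rewrite !inE; apply/andP; split.
    apply: contraNneq fg => ->; rewrite mcoeffB raddfMz /= (leading_coef lead).
    by rewrite intz subrr.
  case: (f@_nu =P 0) => [f0|/eqP/supp/(_ dnu) //].
  move: fg; rewrite mcoeffB f0 sub0r oppr_eq0 raddfMz /= => gnu.
  have /(leading_supp lead)[->//|bel] : (weight_monomial mu)@_nu != 0.
    by apply: contraNneq gnu => ->; rewrite mul0rz.
  exact: (down nu mu).
Qed.

(** The dominant weights of squared norm at most [c] form a finite set, downward closed by
    [below_normsq]; taking [c] as the sum over the support bounds each term. *)
Lemma W_invariant_constant_mod f : W_invariant C f -> constant_mod f.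
Proof.
move=> inv; pose c := \sum_(mu <- msupp f) normsq mu.
have [B HB] := finite_normsq c.
pose domb mu := [forall i, 0 <= mu 0 i].
have dombP mu : reflect (dominant mu) (domb mu) by apply: forallP.
apply: (@W_invariant_constant_mod_on [fset mu in B | domb mu && (normsq mu <= c)]) => //.
- by move=> mu; rewrite !inE => /and3P[_ /dombP].
- move=> nu mu; rewrite !inE => /and3P[_ /dombP dmu muc] dnu bel.
  have nuc : normsq nu <= c by apply: le_trans (below_normsq dnu dmu bel) muc.
  by rewrite nuc HB //= andbT; apply/dombP.
- move=> mu; rewrite mcoeff_neq0 => muf dmu; rewrite !inE.
  have muc : normsq mu <= c.
    rewrite /c (big_fsetD1 mu muf) /= lerDl sumr_ge0 // => nu _; exact: bform_ge0.
  by rewrite muc HB //= andbT; apply/dombP.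
Qed.

Lemma I_scP f : I_sc C f <-> rho_ideal f.
Proof.
split=> [[m [c [g [H ->]]]]|[F ->]].
  elim/big_ind: _ => [||k _]; [exact: rho_ideal0|exact: rho_idealD|].
  apply: rho_idealMl; have [_ [inv aug]] := H k.
  by have := W_invariant_constant_mod inv; rewrite /constant_mod aug subr0.
exists n, F, (fun j => rhoj C j); split=> // j; split=> //; split.
  apply: W_invariantB; first exact: W_invariant_rho.
  by rewrite pmulrn; apply/W_invariantMz/W_invariant1.
by rewrite raddfB /= augm_rho rmorph_nat subrr.
Qed.

End RootSystem.

(** * The sublattice of index two *)

Section IndexTwo.
Context (n : nat) (C : 'M[int]_n) (T : lat n -> Prop) (n' : nat).
Context (a : nat -> nat -> int) (l0 : lat n).
Hypothesis T0 : T 0.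
Hypothesis TB : forall x y, T x -> T y -> T (x - y).
Hypothesis T_index2 : exists l1, ~ T l1 /\ forall mu, T mu \/ T (mu - l1).
Hypothesis T_root : forall i, T (row i C).
Hypothesis n'_le : (n' <= n)%N.
Hypothesis T_omega : forall i : 'I_n, ~ T (omegan n i) <-> (i < n')%N.
Hypothesis bezout : forall i, (i < n')%N ->
  (dd C n' i)%:Z = \sum_(i <= j < n') a i j * (ssz C j)%:Z.
Hypothesis Tl0 : ~ T l0.
Hypothesis orbitE : forall l mu, mu \in orbit C l -> in_orbit C l mu.
Hypothesis s_gt0 : forall j, (0 < ssz C j)%N.
Implicit Types (f g h : ZL n) (x y : lat n).

(** * Parity of weights and soundness of the generators *)

Lemma TN x : T x -> T (- x).
Proof. by move=> Tx; rewrite -sub0r; apply: TB. Qed.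

Lemma TD x y : T x -> T y -> T (x + y).
Proof. by move=> Tx Ty; rewrite -[y]opprK; apply: TB (TN Ty). Qed.

Lemma TMz x (z : int) : T x -> T (z *: x).
Proof.
move=> Tx; have Tn (k : nat) : T (k%:Z *: x).
  elim: k => [|k IH]; first by rewrite scale0r.
  by rewrite intS scalerDl scale1r; apply: TD.
by case: z => k //; rewrite NegzE scaleNr; apply: TN.
Qed.

Lemma T_addK x y : T y -> (T (x + y) <-> T x).
Proof.
by move=> Ty; split=> Tx; [rewrite -(addrK y x); apply: TB|apply: TD].
Qed.

Lemma T_odd_odd x y : ~ T x -> ~ T y -> T (x + y).
Proof.
have [l1 [_ cos]] := T_index2; move=> Tx Ty.
have [//|H1] := cos x; have [/TN|H2] := cos (- y); first by rewrite opprK.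
by have := TB H1 H2; rewrite opprB addrA subrK opprK.
Qed.

Lemma T_odd_even x y : ~ T x -> T y -> ~ T (x + y).
Proof. by move=> Tx Ty /T_addK - /(_ Ty). Qed.

Definition evenb mu : bool := if excluded_middle_informative (T mu) then true else false.

Lemma evenP mu : reflect (T mu) (evenb mu).
Proof. by rewrite /evenb; case: excluded_middle_informative => H; constructor. Qed.

Lemma evenb_odd x y : ~ T y -> evenb (x + y) = ~~ evenb x.
Proof.
move=> Ty; apply/evenP/negP => [Txy /evenP Tx|Tx].
  by apply: Ty; rewrite -(addKr x y); apply: TD Txy; apply: TN.
by apply: T_odd_odd => // /evenP.
Qed.

Lemma evenb_even x y : T y -> evenb (x + y) = evenb x.
Proof. by move=> Ty; apply/evenP/evenP => /(T_addK _ Ty). Qed.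

Definition part0 f := restr evenb f.
Definition part1 f := restr (predC evenb) f.

Lemma restr_mul_odd h f : supp_in (fun mu => ~ T mu) f ->
  part0 (h * f) = part1 h * f /\ part1 (h * f) = part0 h * f.
Proof.
move=> odd; split; apply: restrM; apply: supp_inW odd => k Tk l /=.
  exact: evenb_odd.
by rewrite evenb_odd // negbK.
Qed.

Lemma restr_mul_even h f : supp_in T f ->
  part0 (h * f) = part0 h * f /\ part1 (h * f) = part1 h * f.
Proof.
by move=> even; split; apply: restrM; apply: supp_inW even => k Tk l /=;
  rewrite evenb_even.
Qed.

Lemma part0_id f : supp_in T f -> part0 f = f.
Proof. by move=> Tf; apply: restr_id => k /Tf /evenP. Qed.

Lemma part1_eq0 f : supp_in T f -> part1 f = 0.
Proof. by move=> Tf; apply: restr_eq0 => k /Tf /evenP /= ->. Qed.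

Lemma part0_sum (F : 'I_n -> ZL n) : part0 (\sum_j F j) = \sum_j part0 (F j).
Proof. exact: raddf_sum. Qed.

Lemma part1_sum (F : 'I_n -> ZL n) : part1 (\sum_j F j) = \sum_j part1 (F j).
Proof. exact: raddf_sum. Qed.

Lemma T_omega_n j : (n' <= j < n)%N -> T (omegan n j).
Proof.
case/andP => le_n'j lt_jn; apply/evenP/negPn/negP => /evenP.
by move/(T_omega (Ordinal lt_jn)) => /=; rewrite ltnNge le_n'j.
Qed.

Lemma T_orbit l mu : mu \in orbit C l -> T (mu - l).
Proof.
move=> /orbitE; elim/weyl_act_ind => [|i nu IH]; first by rewrite subrr.
by rewrite /refl addrAC; apply: TB (TMz _ (T_root i)).
Qed.

Lemma rhoo_odd j : (j < n')%N -> supp_in (fun mu => ~ T mu) (rhoo C j).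
Proof.
move=> jn; rewrite /rhoo /rho big_seq; apply: supp_in_sum => mu muo; apply: supp_inU.
have Tj : ~ T (omegan n j) by apply/(T_omega (Ordinal (leq_trans jn n'_le))).
by rewrite -(subrK (omegan n j) mu) addrC; apply: T_odd_even (T_orbit muo).
Qed.

Lemma rhoo_even j : (n' <= j < n)%N -> supp_in T (rhoo C j).
Proof.
move=> jn; rewrite /rhoo /rho big_seq; apply: supp_in_sum => mu muo; apply: supp_inU.
by rewrite -(subrK (omegan n j) mu); apply: TD (T_orbit muo) (T_omega_n jn).
Qed.

Lemma supp_int (z : int) : supp_in T (z%:~R : ZL n).
Proof.
have supp_nat (k : nat) : supp_in T (k%:R : ZL n).
  elim: k => [|k IH]; first exact: supp_in0.
  by rewrite mulrS; apply: supp_inD IH; apply: supp_inU.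
case: z => k; first by rewrite -pmulrn.
by rewrite NegzE mulrNz -pmulrn; apply: supp_inN.
Qed.

Lemma supp_nat (k : nat) : supp_in T (k%:R : ZL n).
Proof. by rewrite pmulrn; apply: supp_int. Qed.

Lemma supp_even_odd f g :
  supp_in T f -> supp_in (fun mu => ~ T mu) g -> supp_in (fun mu => ~ T mu) (f * g).
Proof.
apply: supp_inM => x y Tx Ty; rewrite addrC; exact: T_odd_even.
Qed.

(** The Bezout identity makes [dd C n' i] cancel the constants of the [rhoj], which leaves a purely
    odd element. *)
Lemma rhotwE i : (i < n')%N ->
  rhotw C n' a i = \sum_(i <= k < n') (a i k)%:~R * rhoo C k.
Proof.
move=> lt_in; rewrite /rhotw /rhot pmulrn bezout // rmorph_sum /= -big_split /=.
by apply: eq_bigr => k _; rewrite /rhoj pmulrn intrM mulrBr subrK.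
Qed.

Lemma rhotw_odd i : (i < n')%N -> supp_in (fun mu => ~ T mu) (rhotw C n' a i).
Proof.
move=> lt_in; rewrite rhotwE // big_nat; apply: supp_in_sum => k /andP[_ kn].
exact: (supp_even_odd (@supp_int _) (rhoo_odd kn)).
Qed.

Lemma dd_rec i : (i < n')%N -> dd C n' i = gcdn (ssz C i) (dd C n' i.+1).
Proof. by move=> lt_in; rewrite /dd big_ltn. Qed.

Lemma dd_gt0 i : (i < n')%N -> (0 < dd C n' i)%N.
Proof. by move=> lt_in; rewrite dd_rec // gcdn_gt0 s_gt0. Qed.

Lemma dd_dvd i k : (i <= k < n')%N -> (dd C n' i %| ssz C k)%N.
Proof.
case/andP; elim: {i}(k - i)%N {-2}i (erefl (k - i)%N) => [|m IH] i Em ik kn.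
  have -> : i = k by lia.
  by rewrite dd_rec // dvdn_gcdl.
rewrite dd_rec; last by lia.
by apply: dvdn_trans (dvdn_gcdr _ _) (IH _ _ _ _) => //; lia.
Qed.

Lemma rho_ideal_nat j : (j < n)%N -> rho_ideal C (rhoj C j).
Proof. by move=> jn; apply: (rho_ideal_gen C (Ordinal jn)). Qed.

Lemma rho_ideal_rhot i : rho_ideal C (rhot C n' a i).
Proof.
rewrite /rhot big_nat; elim/big_ind: _ => [||k /andP[_ kn]].
- exact: rho_ideal0.
- exact: rho_idealD.
- by apply/rho_idealMl/rho_ideal_nat/(leq_trans kn).
Qed.

Lemma gens_h_sound g : gens_h C n' a l0 g -> supp_in T g /\ rho_ideal C g.
Proof.
case=> [[i [lt_in ->]]|[[i [lt_in ->]]|[i [ni ->]]]].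
- split.
    have H : supp_in (fun mu => ~ T mu) ((rr C n' i %/ ssz C i)%:R * rhoo C i
             - (rr C n' i %/ dd C n' i.+1)%:R * rhotw C n' a i.+1).
      apply: supp_inD; last apply: supp_inN.
        exact: (supp_even_odd (@supp_nat _) (rhoo_odd (ltnW lt_in))).
      exact: (supp_even_odd (@supp_nat _) (rhotw_odd lt_in)).
    have Hl : supp_in (fun mu => ~ T mu) (ex l0) by apply: supp_inU.
    exact: (supp_inM T_odd_odd Hl H).
  rewrite /h1 /rhotw; apply: rho_idealMl.
  have -> : rhoo C i = rhoj C i + (ssz C i)%:R by rewrite subrK.
  move: (rhoj C i) (rho_ideal_nat (leq_trans (ltnW lt_in) n'_le)) => p Ip.
  (* Both constant terms become [rr C n' i], which is why the multipliers use the lcm, and they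
     cancel. *)
  rewrite !mulrDr -!natrM divnK ?dvdn_lcml // divnK ?dvdn_lcmr //.
  rewrite opprD addrACA subrr addr0 -mulNr; apply: rho_idealD.
    exact: rho_idealMl.
  exact/rho_idealMl/rho_ideal_rhot.
- split.
    apply: supp_inD; last by apply: supp_inN; apply: supp_nat.
    have n'0 : (0 < n')%N by lia.
    exact: (supp_inM T_odd_odd (rhoo_odd lt_in) (rhotw_odd n'0)).
  have -> : h2 C n' a i = rhoo C i * rhot C n' a 0 + (dd C n' 0)%:R * rhoj C i.
    by rewrite /h2 /rhotw /rhoj natrM; ring.
  apply: rho_idealD; first exact/rho_idealMl/rho_ideal_rhot.
  by apply/rho_idealMl/rho_ideal_nat/(leq_trans lt_in).
- split; last by apply: rho_ideal_nat; case/andP: ni.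
  apply: supp_inD; first exact: rhoo_even.
  by apply: supp_inN; apply: supp_nat.
Qed.

(** Coefficients may be arbitrary here, so odd units such as [ex (- l0)] are available;
    [in_ideal_part0] brings them back to [T]. *)
Let M := gen_ideal (fun=> True) (gens_h C n' a l0).

(* The integer relations among [s_i, ..., s_{n'-1}] are generated by those
   coming from [h1], by the usual elimination of the first coefficient. *)
Lemma linear_form_in_ideal i (c : nat -> int) : (i <= n')%N ->
  \sum_(i <= k < n') c k * (ssz C k)%:Z = 0 ->
  M (\sum_(i <= k < n') (c k)%:~R * rhoo C k).
Proof.
elim: {i}(n' - i)%N {-2}i (erefl (n' - i)%N) c => [|m IH] i Em c le_in.
  by rewrite !big_geq; [move=> _; apply: gen_ideal0|lia..].
have lt_in : (i < n')%N by lia.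
rewrite !(big_ltn lt_in) => E.
have [lt1|ge1] := ltnP i.+1 n'; last first.
  move: E; rewrite !big_geq // !addr0 => /eqP.
  rewrite mulf_eq0 eqz_nat (gtn_eqF (s_gt0 i)) orbF => /eqP ->.
  by rewrite mul0r; apply: gen_ideal0.
pose s := ssz C i; pose D := dd C n' i.+1; pose r := rr C n' i.
(* All later terms of the relation are multiples of [D], so [c i * s] is a common multiple of [s]
   and [D], hence of [r]. *)
have dvdD : (D%:Z %| c i * s%:Z)%Z.
  have -> : c i * s%:Z = - \sum_(i.+1 <= k < n') c k * (ssz C k)%:Z.
    by apply/eqP; rewrite -addr_eq0 E.
  rewrite rpredN big_nat; apply: rpred_sum => k ik; rewrite dvdz_mull //.
  by rewrite dvdzE; apply: dd_dvd.
have dvdE : (r%:Z %| c i * s%:Z)%Z.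
  by move: dvdD; rewrite !dvdzE => dvdD; rewrite dvdn_lcm dvdD abszM dvdn_mull.
have [z Ez] := dvdzP dvdE.
have s0 : s%:Z != 0 by rewrite eqz_nat -lt0n s_gt0.
have rs : r%:Z = (r %/ s)%:Z * s%:Z by rewrite -PoszM divnK ?dvdn_lcml.
have rD : r%:Z = (r %/ D)%:Z * D%:Z by rewrite -PoszM divnK ?dvdn_lcmr.
have ci : c i = z * (r %/ s)%:Z by apply: (mulIf s0); rewrite -mulrA -rs.
(* Removing [z] copies of the relation behind [h1] clears the coefficient at [i] and shifts the
   later ones by these multiples of the Bezout coefficients. *)
pose c' k := c k + z * (r %/ D)%:Z * a i.+1 k.
have Hc' : M (\sum_(i.+1 <= k < n') (c' k)%:~R * rhoo C k).
  apply: IH => //; first by lia.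
  under eq_bigr do rewrite mulrDl -mulrA.
  rewrite big_split /= -mulr_sumr -bezout // -mulrA -rD.
  by move: E; rewrite -/s Ez addrC.
have Hh : M (h1 C n' a l0 i) by apply: gen_ideal_gen; left; exists i.
have -> : (c i)%:~R * rhoo C i + \sum_(i.+1 <= k < n') (c k)%:~R * rhoo C k =
    z%:~R * (ex (- l0) * h1 C n' a l0 i) + \sum_(i.+1 <= k < n') (c' k)%:~R * rhoo C k.
  rewrite /h1 exNK rhotwE // ci -/r -/s -/D intrM !pmulrn.
  rewrite mulrBr mulrA -addrA; congr (_ + _).
  rewrite mulrA -intrM mulr_sumr -sumrN -big_split; apply: eq_bigr => k _ /=.
  by rewrite /c' !(intrD, intrM); ring.
by apply: gen_idealD Hc'; do 2! apply: gen_idealMl.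
Qed.

(** Multiplication by a generator preserves parity, so the even part of a combination is obtained
    from the even parts of its coefficients. *)
Lemma in_ideal_part0 f : supp_in T f -> M f -> gen_ideal (in_ZT T) (gens_h C n' a l0) f.
Proof.
move=> /part0_id fT [m [c [g [H Ef]]]].
rewrite -fT Ef /part0 raddf_sum; apply: gen_ideal_sum => k _.
have [_ gk] := H k; have [gT _] := gens_h_sound gk.
have [E0 _] := restr_mul_even (c k) gT; rewrite /= -/(part0 _) E0.
by apply: gen_ideal_mul => //; apply/in_ZTP => mu /supp_restr /evenP.
Qed.

(** Otherwise all fundamental weights, and with them [l0], would lie in [T]. *)
Lemma n'_gt0 : (0 < n')%N.
Proof.
rewrite lt0n; apply/eqP => n0; apply: Tl0.
rewrite (row_sum_delta l0); elim/big_ind: _ => // [|i _]; first exact: TD.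
apply: TMz; have -> : delta_mx 0 i = omegan n i.
  by apply/rowP => k; rewrite !mxE eqxx.
by apply: T_omega_n; rewrite n0 /=.
Qed.

(** * Completeness of the generators *)

Hypothesis flat : gen_flatness (fun i : 'I_n => rhoj C i).

Let D := dd C n' 0.

Lemma D_torsion f : D%:R * f = 0 -> f = 0.
Proof.
move=> Df; apply/malgP => mu; have /malgP/(_ mu) := Df.
rewrite mulr_natl mcoeffMn mcoeff0 => /eqP.
by rewrite mulrn_eq0 (gtn_eqF (dd_gt0 n'_gt0)) => /eqP.
Qed.

(** The part of a coefficient whose product with [rhoo C j] is odd. *)
Let own (j : nat) f := if (j < n')%N then part0 f else part1 f.

Fact own_is_additive j : zmod_morphism (own j).
Proof. by move=> f g; rewrite /own; case: ifP => _; rewrite /part0 /part1 raddfB. Qed.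
HB.instance Definition _ j :=
  GRing.isZmodMorphism.Build (ZL n) (ZL n) (own j) (own_is_additive j).

Lemma own_id j f : own j (own j f) = own j f.
Proof.
by rewrite /own /part0 /part1; case: (j < n')%N; apply: (restr_id (@supp_restr _ _ _ f)).
Qed.

Lemma part_rhoj j h : (j < n)%N ->
  if (j < n')%N then
    part0 (h * rhoj C j) = part1 h * rhoo C j - (ssz C j)%:R * part0 h /\
    part1 (h * rhoj C j) = part0 h * rhoo C j - (ssz C j)%:R * part1 h
  else part0 (h * rhoj C j) = part0 h * rhoj C j /\
       part1 (h * rhoj C j) = part1 h * rhoj C j.
Proof.
move=> jn; case: ifP => jn'.
  have [E0 E1] := restr_mul_odd h (rhoo_odd jn').
  rewrite /rhoj mulrBr [h * _%:R]mulrC.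
  rewrite /part0 /part1 in E0 E1 *.
  by rewrite !raddfB /= !restr_nat_mul E0 E1.
apply: restr_mul_even; apply: supp_inD; last by apply: supp_inN; apply: supp_nat.
by apply: rhoo_even; rewrite leqNgt jn'.
Qed.

Lemma ideal_complete f : supp_in T f -> rho_ideal C f -> M f.
Proof.
move=> Tf [F Ef]; have f0 := part0_id Tf; have f1 := part1_eq0 Tf.
have n'0 := n'_gt0.
pose t j := (ssz C j %/ D)%N.
have st j : (j < n')%N -> (ssz C j)%:R = D%:R * (t j)%:R :> ZL n.
  by move=> jn; rewrite -natrM mulnC divnK //; apply: dd_dvd.
pose q : 'rV[ZL n]_n := \row_j rhoj C j.
pose g : 'cV[ZL n]_n := \col_j own j (F j).
pose w := \sum_(j < n)
  (if (j < n')%N then (t j)%:R * (part1 (F j) - part0 (F j)) else 0).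
(* The odd part of [f] vanishes. Trading [rhoo] for [rhoj] in it leaves errors that are multiples of
   the [ssz C j] with [j < n'], hence of [D]; [w] collects their quotients. *)
have Eg : q *m g = (D%:R * w)%:M.
  apply/matrixP => i k; rewrite !ord1 !mxE eqxx mulr1n.
  transitivity (\sum_(j < n) part1 (F j * rhoj C j) + D%:R * w); last first.
    by rewrite -part1_sum -Ef f1 add0r.
  rewrite mulr_sumr -big_split; apply: eq_bigr => j _ /=; rewrite !mxE.
  have := part_rhoj (F j) (ltn_ord j); rewrite /own.
  case: ifP => jn [_ ->]; last by rewrite mulr0 addr0 mulrC.
  by rewrite mulrA -st // /rhoj; ring.
have [V [v Ev]] := gen_flatness_koszul flat Eg.
pose u := (V - V^T) *m (\col_i rhoj C i).
pose F' (j : 'I_n) := F j - u j 0.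
have Ef' : f = \sum_j F' j * rhoj C j.
  rewrite Ef; under [RHS]eq_bigr do rewrite mulrBl.
  rewrite big_split /= sumrN -[LHS]addr0; congr (_ + _).
  apply/esym/eqP; rewrite oppr_eq0; apply/eqP.
  (* [q V q^T] is a [1 x 1] matrix, so it equals its transpose [q V^T q^T]; thus passing from [F] to
     [F'] leaves [f] unchanged. *)
  have : q *m u = 0.
    rewrite /u mulmxA mulmxBr mulmxBl.
    have -> : q *m V^T *m (\col_i rhoj C i) = (q *m V *m (\col_i rhoj C i))^T.
      have -> : (\col_i rhoj C i) = q^T by apply/colP => i; rewrite !mxE.
      by rewrite !trmx_mul trmxK mulmxA.
    by apply/matrixP => i k; rewrite !ord1 !mxE subrr.
  move=> /matrixP/(_ 0 0); rewrite !mxE => E; rewrite -[RHS]E.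
  by apply: eq_bigr => j _; rewrite [q 0 j]mxE mulrC.
pose v' (j : 'I_n) := own j (v j 0).
(* [F' j] is [F j - own j (F j)], which [own j] kills, plus [D] times [v j 0]. *)
have ownF' (j : 'I_n) : own j (F' j) = D%:R * v' j.
  have Eu : u j 0 = own j (F j) - D%:R * v j 0.
    have : g j 0 = (u + D%:R *: v) j 0 by rewrite Ev.
    by rewrite [g j 0]mxE [(u + _) j 0]mxE [(_ *: v) j 0]mxE => ->; rewrite addrK.
  rewrite /F' Eu opprB addrCA raddfD raddfB /= own_id subrr addr0.
  by rewrite !mulr_natl raddfMn.
(* The odd part of [F' j * rhoj C j] divided by [D]; these quotients sum to zero because the group
   ring has no [D]-torsion. *)
pose b (j : 'I_n) := if (j < n')%N then v' j * rhoo C j - (t j)%:R * part1 (F' j)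
                     else v' j * rhoj C j.
have Db (j : 'I_n) : D%:R * b j = part1 (F' j * rhoj C j).
  have := part_rhoj (F' j) (ltn_ord j); have := ownF' j; rewrite /b /own.
  case: ifP => jn -> [_ ->]; last by rewrite mulrA.
  by rewrite st // mulrBr !mulrA.
have b0 : \sum_j b j = 0.
  apply: D_torsion; rewrite mulr_sumr -[RHS]f1 Ef' part1_sum.
  by apply: eq_bigr => j _; rewrite Db.
(* Adding this multiple of the vanishing sum makes each summand separately a member of [M]. *)
have -> : f = \sum_j (part0 (F' j * rhoj C j) + rhotw C n' a 0 * b j).
  by rewrite big_split /= -mulr_sumr b0 mulr0 addr0 -part0_sum -Ef' f0.
apply: gen_ideal_sum => j _.
have := part_rhoj (F' j) (ltn_ord j); have := ownF' j; rewrite /b /own.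
case: ifP => jn E [-> _]; last first.
  have Mh : M (rhoj C j).
    by apply: gen_ideal_gen; right; right; exists (j : nat); rewrite leqNgt jn ltn_ord.
  by rewrite mulrA -mulrDl; apply: gen_idealMl.
have Mh : M (h2 C n' a j) by apply: gen_ideal_gen; right; left; exists (j : nat).
(* By Bezout this is an integer combination of the [rhoo] whose augmentation is
   [ssz C j - t j * D = 0]. *)
have Ml : M (rhoo C j - (t j)%:R * rhotw C n' a 0).
  pose c k : int := (k == j :> nat)%:R - (t j)%:Z * a 0 k.
  have sumc (R : comRingType) (G : nat -> R) :
      \sum_(0 <= k < n') (k == j :> nat)%:R * G k = G j.
    rewrite (bigD1_seq (j : nat)) ?mem_index_iota ?iota_uniq //= eqxx mul1r.
    by rewrite big1 ?addr0 // => k /negPf ->; rewrite mul0r.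
  have -> : rhoo C j - (t j)%:R * rhotw C n' a 0 =
      \sum_(0 <= k < n') (c k)%:~R * rhoo C k.
    rewrite rhotwE // -[in LHS](sumc _ (fun k => rhoo C k)) mulr_sumr -sumrN -big_split.
    apply: eq_bigr => k _ /=.
    by rewrite /c rmorphB rmorphM /= rmorph_nat mulrBl -pmulrn mulrA.
  apply: linear_form_in_ideal => //.
  under eq_bigr do rewrite mulrBl -mulrA.
  rewrite big_split /= sumc sumrN -mulr_sumr -bezout // -PoszM divnK ?subrr //.
  exact: dd_dvd.
have -> : part1 (F' j) * rhoo C j - (ssz C j)%:R * part0 (F' j) + rhotw C n' a 0 *
    (v' j * rhoo C j - (t j)%:R * part1 (F' j)) =
    part1 (F' j) * (rhoo C j - (t j)%:R * rhotw C n' a 0) + v' j * h2 C n' a j.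
  by rewrite E /h2 natrM -/D; ring.
by apply: gen_idealD; apply: gen_idealMl.
Qed.

End IndexTwo.

Theorem theorem3p4 (n : nat) (C : 'M[int]_n) (T : lat n -> Prop) (n' : nat)
    (a : nat -> nat -> int) (l0 : lat n) :
  finite_cartan C ->
  (* T : a subgroup of index 2 of Lambda containing the root lattice *)
  T 0 -> (forall x y, T x -> T y -> T (x - y)) ->
  (exists l1, ~ T l1 /\ forall mu, T mu \/ T (mu - l1)) ->
  (forall i, T (row i C)) ->
  (* ordering: omega_0 .. omega_{n'-1} not in T, the others in T *)
  (n' <= n)%N -> (forall i : 'I_n, ~ T (omegan n i) <-> (i < n')%N) ->
  (* the chosen integers a_{i,j} *)
  (forall i, (i < n')%N ->
     (dd C n' i)%:Z = \sum_(i <= j < n') a i j * (ssz C j)%:Z) ->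
  ~ T l0 ->
  gen_flatness (fun i : 'I_n => rhoj C i) ->
  forall f : ZL n,
    (in_ZT T f /\ I_sc C f) <-> gen_ideal (in_ZT T) (gens_h C n' a l0) f.
Proof.
move=> [Cii Cle [d [d0 sym pd]]] T0 TB Tidx Troot n'n Tom bez Tl0 flat f.
have orbE l mu : mu \in orbit C l -> in_orbit C l mu.
  by move/(orbitP Cii d0 sym pd).
have s0 j : (0 < ssz C j)%N := ssz_gt0 Cii d0 sym pd j.
split=> [[/in_ZTP Tf /(I_scP Cii Cle d0 sym pd) If]|[m [c [g [H ->]]]]].
  apply: (in_ideal_part0 T0 TB Tidx Troot n'n Tom bez Tl0 orbE Tf).
  exact: (ideal_complete T0 TB Tidx Troot n'n Tom bez Tl0 orbE s0 flat Tf If).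
have sound k := gens_h_sound T0 TB Tidx Troot n'n Tom bez Tl0 orbE (proj2 (H k)).
split.
  apply/in_ZTP; apply: supp_in_sum => k _; have [/in_ZTP ck _] := H k.
  exact: (supp_inM (TD T0 TB) ck (proj1 (sound k))).
apply/(I_scP Cii Cle d0 sym pd); elim/big_ind: _ => [||k _].
- exact: rho_ideal0.
- exact: rho_idealD.
- by apply: rho_idealMl; have [] := sound k.
Qed.
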